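(* Let $\mathbb K$ be a field of characteristic zero, $A$ a unital associative $\mathbb K$-algebra that is formally smooth relative to a $\mathbb K$-subalgebra $S$, and $\nabla$ an $S^{\mathrm e}$-linear connection on the left $A^{\mathrm e}$-module $\Omega^1_SA$. Let $\Pi$ be an $S$-linear double bracket on $A$ with $\Pi+\Pi^\circ=\mathrm{ad}_{\mathrm{ad}_e}$ for some symmetric $e\in A\otimes A$, i.e. $e'\otimes e''=e''\otimes e'$, with $\mathrm{ad}_e\in\mathrm{DDer}_S(A)$. Then the map $\delta^{\mathrm{Ham}_\Pi,\nabla}\colon|A|\to|A^{\mathrm e}|\cong|A|\otimes|A|$ is skew-symmetric if and only if $\mathrm{sym}\circ|\mathbf m_{\Pi,\nabla,\mathrm{ad}_e}|=0$. In particular, if $\mathbf m_{\Pi,\nabla,\mathrm{ad}_e}=0$, then $\delta^{\mathrm{Ham}_\Pi,\nabla}$ is skew-symmetric.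
   Context: Unadorned tensor products are over $\mathbb K$. $A^{\mathrm{op}}$ has elements $\bar a$ ($a\in A$) with $\bar a\bar b=\overline{ba}$; $A^{\mathrm e}=A\otimes A^{\mathrm{op}}$, $S^{\mathrm e}=S\otimes S^{\mathrm{op}}$. $A$-bimodules are identified with left $A^{\mathrm e}$-modules by $(a\otimes\bar b)m=amb$. Sweedler notation $x=x'\otimes x''$ is used. $A\otimes A$ has the outer bimodule structure $x\cdot(a\otimes b)\cdot y=xa\otimes by$ (the default) and the inner one $x\cdot_{\mathrm{in}}(a\otimes b)\cdot_{\mathrm{in}}y=ay\otimes xb$. For an algebra $B$ with subalgebra $R$, $\Omega^1_RB=\mathrm{Ker}(B\otimes_RB\to B)$ with $db=1\otimes b-b\otimes1$; a derivation is $R$-linear if it vanishes on $R$; for an $R$-linear derivation $f\colon B\to M$ into a $B$-bimodule, $i_f\colon\Omega^1_RB\to M$ is the bimodule map with $i_f\circ d=f$. An $R$-linear connection on a left $B$-module $M$ is a $\mathbb K$-linear $\nabla\colon M\to\Omega^1_RB\otimes_BM$ with $\nabla(bm)=db\otimes m+b\nabla(m)$. $A$ is formally smooth relative to $S$ if $\Omega^1_SA$ is a finitely generated projective $A^{\mathrm e}$-module. $\mathrm{Der}_S(A)$ is the space of $S$-linear derivations $A\to A$; $\mathrm{DDer}_S(A)$ is the space of $S$-linear derivations $A\to A\otimes A$, an $A$-bimodule by $(a\cdot\Theta\cdot b)(x)=\Theta'(x)b\otimes a\Theta''(x)$. For a $B$-bimodule $M$, $|M|=M/\langle bm-mb\rangle$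 with class of $m$ written $|m|$; a derivation $f\colon B\to M$ induces $|f|\colon|B|\to|M|$. $|A^{\mathrm e}|\cong|A|\otimes|A|$ via $|x\otimes\bar y|\leftrightarrow|x|\otimes|y|$. For an element $m$ of an $A$-bimodule, $\mathrm{ad}_m(a)=a\cdot m-m\cdot a$; so $\mathrm{ad}_e\colon A\to A\otimes A$, and $\mathrm{ad}_{\mathrm{ad}_e}\colon A\to\mathrm{DDer}_S(A)$. **Double brackets.** An $S$-linear double bracket is a $\mathbb K$-linear $\Pi\colon A\otimes A\to A\otimes A$ with $\Pi(a,bc)=\Pi(a,b)\cdot c+b\cdot\Pi(a,c)$, $\Pi(ab,c)=\Pi(a,c)\cdot_{\mathrm{in}}b+a\cdot_{\mathrm{in}}\Pi(b,c)$, $\Pi(a,s)=\Pi(s,a)=0$ for $s\in S$; equivalently an $S$-linear derivation $A\to\mathrm{DDer}_S(A)$, $a\mapsto\Pi(a,\cdot)$. $\Pi^\circ(a,b)=\Pi''(b,a)\otimes\Pi'(b,a)$. $\mathrm{Ham}_\Pi\colon|A|\to\mathrm{Der}_S(A)$ is $|a|\mapsto\mathrm{mult}\circ\Pi(a,\cdot)$, $\mathrm{mult}$ being the multiplication of $A$. **Traces.** For an algebra $B$, a finitely generated projective left $B$-module $N$ and a $B$-bimodule $M$, $\mathrm{Tr}\colon\mathrm{Hom}_B(N,M\otimes_BN)\cong N^*\otimes_BM\otimes_BN\to|M|$ sends $\theta\otimes m\otimes n$ to $|\theta(n)m|$. **Double divergence.** For $f\in\mathrm{Der}_S(A)$, $f^{\mathrm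 e}(a\otimes\bar b)=f(a)\otimes\bar b+a\otimes\overline{f(b)}$, $L_f(a_0da_1)=f(a_0)da_1+a_0df(a_1)$ on $\Omega^1_SA$, and $\mathrm{Div}^\nabla(f)=\mathrm{Tr}((i_{f^{\mathrm e}}\otimes\mathrm{id})\circ\nabla-L_f)\in|A^{\mathrm e}|$. $\delta^{\mathrm{Ham}_\Pi,\nabla}=\mathrm{Div}^\nabla\circ\mathrm{Ham}_\Pi$. **Triple divergence.** $\mathrm{trip}(A)=(A\otimes A\otimes A^{\mathrm{op}})\oplus(A\otimes A^{\mathrm{op}}\otimes A^{\mathrm{op}})$ is an $A^{\mathrm e}$-bimodule by $(a\otimes\bar b)(x\otimes y\otimes\bar z)=ax\otimes y\otimes\bar b\bar z$, $(x\otimes y\otimes\bar z)(a\otimes\bar b)=x\otimes ya\otimes\bar z\bar b$, $(a\otimes\bar b)(x\otimes\bar y\otimes\bar z)=ax\otimes\bar b\bar y\otimes\bar z$, $(x\otimes\bar y\otimes\bar z)(a\otimes\bar b)=xa\otimes\bar y\otimes\bar z\bar b$. For a left $A^{\mathrm e}$-module $M$, $\mathrm{trip}(A)\otimes_{A^{\mathrm e}}M\cong(A\otimes M)\oplus(M\otimes A)$ by $(x\otimes y\otimes\bar z)\otimes m\leftrightarrow x\otimes ymz$, $(x\otimes\bar y\otimes\bar z)\otimes m\leftrightarrow xmz\otimes y$. Also $|\mathrm{trip}(A)|\cong(A\otimes|A|)\oplus(|A|\otimes A)$ by $x\otimes y\otimes\bar z\leftrightarrow yx\otimes|z|$, $x\otimes\bar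 y\otimes\bar z\leftrightarrow|x|\otimes yz$. For $\Theta\in\mathrm{DDer}_S(A)$, $\Theta^{\mathrm{op}}(\bar a)=\overline{\Theta''(a)}\otimes\overline{\Theta'(a)}$; $\Theta^{\mathrm e}\colon A^{\mathrm e}\to\mathrm{trip}(A)$, $\Theta^{\mathrm e}(a\otimes\bar b)=\Theta(a)\otimes\bar b+a\otimes\Theta^{\mathrm{op}}(\bar b)$; $L_\Theta(a_0da_1)=\Theta'(a_0)\otimes\Theta''(a_0)da_1+a_0d\Theta'(a_1)\otimes\Theta''(a_1)+a_0\Theta'(a_1)\otimes d\Theta''(a_1)$ in $(\Omega^1_SA\otimes A)\oplus(A\otimes\Omega^1_SA)\cong\mathrm{trip}(A)\otimes_{A^{\mathrm e}}\Omega^1_SA$; and $\mathrm{TDiv}^\nabla(\Theta)=\mathrm{Tr}((i_{\Theta^{\mathrm e}}\otimes\mathrm{id})\circ\nabla-L_\Theta)\in|\mathrm{trip}(A)|$. $\phi_{\Pi,\nabla}(a)=\mathrm{TDiv}^\nabla(\Pi(a,\cdot))$. **Modular vector field.** $\mathrm{fd}\colon(A\otimes|A|)\oplus(|A|\otimes A)\to A\otimes|A|$, $x\otimes|y|+|z|\otimes w\mapsto x\otimes|y|+w\otimes|z|$. If $\Pi+\Pi^\circ=\mathrm{ad}_\Theta$ with $\Theta\in\mathrm{DDer}_S(A)$, then $\mathbf m_{\Pi,\nabla,\Theta}\colon A\to A\otimes|A|$, $\mathbf m_{\Pi,\nabla,\Theta}(a)=\mathrm{fd}(\phi_{\Pi,\nabla}(a))+\Theta'(a)\otimes|\Theta''(a)|$,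 is a derivation ($A$ acting on the first factor of $A\otimes|A|$), hence induces $|\mathbf m_{\Pi,\nabla,\Theta}|\colon|A|\to|A|\otimes|A|$. $\mathrm{sym}\colon|A|\otimes|A|\to|A|\otimes|A|$ is $x\otimes y\mapsto x\otimes y+y\otimes x$; a map $\delta\colon|A|\to|A|\otimes|A|$ is skew-symmetric if $\mathrm{sym}\circ\delta=0$. *)

(* Defs.v *)
From HB Require Import structures.
From mathcomp Require Import all_boot all_order all_algebra.
From mathcomp Require Import boolp classical_sets functions.
From mathcomp Require Import generic_quotient ring_quotient.
From mathcomp.multinomials Require Import freeg.

Set Implicit Arguments.
Unset Strict Implicit.
Unset Printing Implicit Defensive.

Import GRing.Theory.
Local Open Scope ring_scope.
Local Open Scope quotient_scope.

Section Converse.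
Variables (K : fieldType).

HB.instance Definition _ (V : lmodType K) := GRing.Lmodule.copy V^c V.

Variable (A : algType K).

Fact converse_scaleAl (k : K) (a b : A^c) : k *: (a * b : A^c) = (k *: a : A^c) * b.
Proof. exact: (scalerAr k (b : A) a). Qed.

HB.instance Definition _ := GRing.Lmodule_isLalgebra.Build K A^c converse_scaleAl.

Fact converse_scaleAr (k : K) (a b : A^c) : k *: (a * b : A^c) = a * (k *: b : A^c).
Proof. exact: (scalerAl k (b : A) a). Qed.

HB.instance Definition _ := GRing.Lalgebra_isAlgebra.Build K A^c converse_scaleAr.
End Converse.

Section Quotient.
Variables (K : fieldType) (V : lmodType K) (G : V -> Prop).

Inductive span : V -> Prop :=
| span_nil : span 0
| span_cons k g x : G g -> span x -> span (k *: g + x).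

Definition spanb : {pred V} := [pred x | `[< span x >]].

Lemma spanP x : reflect (span x) (x \in spanb).
Proof. exact: asboolP. Qed.

Lemma span_lin k x y : span x -> span y -> span (k *: x + y).
Proof.
move=> sx sy; elim: sx => [|c g z Gg _ IH]; first by rewrite scaler0 add0r.
by rewrite scalerDr scalerA -addrA; apply: span_cons.
Qed.

Lemma span_gen g : G g -> span g.
Proof. by move=> Gg; rewrite -[g]addr0 -[g in g + _]scale1r; apply: span_cons => //; left. Qed.

Fact spanb_submod : submod_closed spanb.
Proof.
split; first by apply/spanP; left.
by move=> k x y /spanP sx /spanP sy; apply/spanP; apply: span_lin.
Qed.

HB.instance Definition _ := GRing.isSubmodClosed.Build K V spanb spanb_submod.

Definition qmod : Type := Quotient.quot spanb.
HB.instance Definition _ := Choice.on qmod.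
HB.instance Definition _ := GRing.Zmodule.on qmod.

Definition qcl (x : V) : qmod := \pi_(Quotient.quot spanb) x.
Definition qrepr (u : qmod) : V := repr (u : Quotient.quot spanb).

Lemma qreprK u : qcl (qrepr u) = u.
Proof. exact: reprK. Qed.

Lemma qclP x y : reflect (qcl x = qcl y) (x - y \in spanb).
Proof. by rewrite Quotient.idealrBE; apply: eqP. Qed.

Lemma qclD : {morph qcl : x y / x + y}.
Proof. exact: (raddfD (\pi_(Quotient.quot spanb))). Qed.

Definition qscale (k : K) (u : qmod) : qmod := qcl (k *: qrepr u).

Lemma qclZ k x : qcl (k *: x) = qscale k (qcl x).
Proof.
apply/qclP; rewrite -scalerBr; apply: rpredZ; apply/qclP.
by rewrite qreprK.
Qed.

Fact qscaleA a b u : qscale a (qscale b u) = qscale (a * b) u.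
Proof. by rewrite -[u]qreprK -!qclZ scalerA. Qed.
Fact qscale1 : left_id 1 qscale.
Proof. by move=> u; rewrite -[u]qreprK -qclZ scale1r. Qed.
Fact qscaleDr : right_distributive qscale +%R.
Proof. by move=> k u v; rewrite -[u]qreprK -[v]qreprK -qclD -!qclZ -qclD scalerDr. Qed.
Fact qscaleDl u : {morph qscale^~ u : a b / a + b}.
Proof. by move=> a b; rewrite -[u]qreprK -!qclZ -qclD scalerDl. Qed.

HB.instance Definition _ :=
  GRing.Zmodule_isLmodule.Build K qmod qscaleA qscale1 qscaleDr qscaleDl.

Fact qcl_linear : linear qcl.
Proof. by move=> k x y; rewrite qclD qclZ. Qed.
HB.instance Definition _ := GRing.isLinear.Build K V qmod *:%R qcl qcl_linear.

Lemma qcl_gen g : G g -> qcl g = 0.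
Proof.
move=> Gg; rewrite -[0](linear0 qcl); apply/qclP.
by rewrite subr0; apply/spanP; apply: span_gen.
Qed.

Section Lift.
Variables (W : lmodType K) (f : V -> W).
Definition qlift (u : qmod) : W := f (qrepr u).

Hypotheses (f_lin : linear f) (f_gen : forall g, G g -> f g = 0).

Lemma span_ker x : span x -> f x = 0.
Proof.
elim=> [|k g y Gg _ IH]; last by rewrite f_lin f_gen // scaler0 add0r.
by have := f_lin (-1) 0 0; rewrite scaler0 addr0 scaleN1r addNr.
Qed.

Lemma qliftE x : qlift (qcl x) = f x.
Proof.
have /qclP/spanP/span_ker : qcl (qrepr (qcl x)) = qcl x by rewrite qreprK.
by rewrite -scaleN1r addrC f_lin scaleN1r addrC => /subr0_eq.
Qed.

Lemma qlift_linear : linear qlift.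
Proof.
by move=> k u v; rewrite -[u]qreprK -[v]qreprK -linearP !qliftE f_lin.
Qed.
End Lift.
End Quotient.

Section Tensor.
Variables (K : fieldType) (M N : lmodType K) (I : Type).
Variables (r : I -> M -> M) (l : I -> N -> N).

Inductive tens_rel : {freeg (M * N)%type / K} -> Prop :=
| tens_relDl m m' n : tens_rel (<< (m + m', n) >> - << (m, n) >> - << (m', n) >>)
| tens_relDr m n n' : tens_rel (<< (m, n + n') >> - << (m, n) >> - << (m, n') >>)
| tens_relZl k m n : tens_rel (<< (k *: m, n) >> - k *: << (m, n) >>)
| tens_relZr k m n : tens_rel (<< (m, k *: n) >> - k *: << (m, n) >>)
| tens_relB i m n : tens_rel (<< (r i m, n) >> - << (m, l i n) >>).

Definition tens : Type := qmod tens_rel.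
HB.instance Definition _ := GRing.Lmodule.on tens.

Definition tpure (m : M) (n : N) : tens := qcl tens_rel << (m, n) >>.

Definition tlift (P : lmodType K) (g : M -> N -> P) (t : tens) : P :=
  fglift (fun p : M * N => g p.1 p.2) (qrepr t).

Record balanced (P : lmodType K) (g : M -> N -> P) : Prop := Balanced {
  bal_l : forall n, linear (g^~ n);
  bal_r : forall m, linear (g m);
  bal_i : forall i m n, g (r i m) n = g m (l i n) }.

Lemma tpureDl n : {morph tpure^~ n : m m' / m + m'}.
Proof.
move=> m m'; apply/eqP; rewrite -subr_eq0 opprD addrA -!linearB /=.
by apply/eqP/qcl_gen; apply: tens_relDl.
Qed.
Lemma tpureDr m : {morph tpure m : n n' / n + n'}.
Proof.
move=> n n'; apply/eqP; rewrite -subr_eq0 opprD addrA -!linearB /=.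
by apply/eqP/qcl_gen; apply: tens_relDr.
Qed.
Lemma tpureZl k m n : tpure (k *: m) n = k *: tpure m n.
Proof.
apply/eqP; rewrite -subr_eq0 -linearZ -linearB /=.
by apply/eqP/qcl_gen; apply: tens_relZl.
Qed.
Lemma tpureZr k m n : tpure m (k *: n) = k *: tpure m n.
Proof.
apply/eqP; rewrite -subr_eq0 -linearZ -linearB /=.
by apply/eqP/qcl_gen; apply: tens_relZr.
Qed.
Lemma tpureB i m n : tpure (r i m) n = tpure m (l i n).
Proof.
apply/eqP; rewrite -subr_eq0 -linearB /=.
by apply/eqP/qcl_gen; apply: tens_relB.
Qed.

Lemma tpure_balanced : balanced tpure.
Proof.
split=> [n k m m'|m k n n'|i m n]; last exact: tpureB.
- by rewrite tpureDl tpureZl.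
- by rewrite tpureDr tpureZr.
Qed.

Lemma tens_ind (Q : tens -> Prop) :
  (forall m n, Q (tpure m n)) -> (forall s t, Q s -> Q t -> Q (s + t)) ->
  forall t, Q t.
Proof.
move=> Q1 QD t; rewrite -[t]qreprK; move: (qrepr t) => {t}.
apply: freeg_ind_dom0 => [|k [m n] D _ _ QDx].
  by have := Q1 0 0; rewrite -[X in tpure X _](scale0r 0) tpureZl scale0r linear0.
rewrite linearD; apply: QD QDx.
suff -> : << k *g (m, n) >> = k *: << (m, n) >> :> {freeg (M * N)%type / K}.
  by rewrite linearZ /= -tpureZl.
by apply/eqP/freeg_eqP => z; rewrite coeffZ !coeffU mul1r.
Qed.

Section Lift.
Variables (P : lmodType K) (g : M -> N -> P).

Let h := fglift (fun p : M * N => g p.1 p.2).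

Let hB x y : h (x - y) = h x - h y.
Proof. exact: lift_is_additive. Qed.

Let h_lin : linear h.
Proof.
have h0 : h 0 = 0 by have := hB 0 0; rewrite !subrr.
have hN y : h (- y) = - h y by rewrite -[- y]add0r hB h0 sub0r.
have hD x y : h (x + y) = h x + h y by rewrite -[y in LHS]opprK hB hN opprK.
move=> k x y; rewrite hD; congr (_ + _).
move: x; apply: freeg_ind_dom0 => [|c p D _ _ IH]; first by rewrite scaler0 h0 scaler0.
rewrite scalerDr !hD scalerDr IH; congr (_ + _).
have -> : k *: << c *g p >> = << k * c *g p >> :> {freeg (M * N)%type / K}.
  by apply/eqP/freeg_eqP => z; rewrite coeffZ !coeffU mulrA.
by rewrite /h !liftU scalerA.
Qed.

Hypothesis g_bal : balanced g.

Let h1 m n : h << (m, n) >> = g m n.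
Proof. by rewrite /h liftU scale1r. Qed.

Let hZ k x : h (k *: x) = k *: h x.
Proof. by rewrite -[k *: x]addr0 h_lin -[0](subrr 0) hB subrr addr0. Qed.

Let h_gen x : tens_rel x -> h x = 0.
Proof.
case: g_bal => gl gr gB [m m' n|m n n'|k m n|k m n|i m n]; rewrite ?hB ?hZ !h1.
- by have := gl n 1 m m'; rewrite !scale1r => ->; rewrite addrAC addrK subrr.
- by have := gr m 1 n n'; rewrite !scale1r => ->; rewrite addrAC addrK subrr.
- have g0 : g 0 n = 0 by have := gl n (-1) 0 0; rewrite scaler0 addr0 scaleN1r addNr.
  by have := gl n k m 0; rewrite g0 !addr0 => ->; rewrite subrr.
- have g0 : g m 0 = 0 by have := gr m (-1) 0 0; rewrite scaler0 addr0 scaleN1r addNr.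
  by have := gr m k n 0; rewrite g0 !addr0 => ->; rewrite subrr.
- by rewrite gB subrr.
Qed.

Lemma tliftE m n : tlift g (tpure m n) = g m n.
Proof. by rewrite -h1; exact: (qliftE h_lin h_gen). Qed.

Lemma tlift_linear : linear (tlift g).
Proof. exact: (qlift_linear h_lin h_gen). Qed.
End Lift.

Lemma tens_ext (P : lmodType K) (f g : tens -> P) :
  linear f -> linear g -> (forall m n, f (tpure m n) = g (tpure m n)) -> f =1 g.
Proof.
move=> fl gl fg; apply: tens_ind => // s t Es Et.
by have := fl 1 s t; have := gl 1 s t; rewrite !scale1r Es Et => -> ->.
Qed.
End Tensor.

Reserved Notation "x ⊗ y" (at level 40, left associativity).
Reserved Notation "b • m" (at level 40, left associativity).
Reserved Notation "b ▷ m" (at level 40, left associativity).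
Reserved Notation "m ◁ b" (at level 40, left associativity).

Arguments tpure {K M N I r l} m n.

Definition void_act (V : Type) : void -> V -> V := fun i _ => match i with end.
Arguments void_act V : clear implicits.

Notation "M ⊗ N" := (tens (void_act M) (void_act N)) : type_scope.
Notation "m ⊗ n" := (tpure m n) : ring_scope.

Definition tmap (K : fieldType) (M N M' N' : lmodType K) (I J : Type)
    (r : I -> M -> M) (l : I -> N -> N) (r' : J -> M' -> M') (l' : J -> N' -> N')
    (f : M -> M') (g : N -> N') (t : tens r l) : tens r' l' :=
  tlift (fun m n => f m ⊗ g n) t.
Arguments tmap {K M N M' N' I J r l r' l'} f g t.

Definition tswap (K : fieldType) (M N : lmodType K) (t : M ⊗ N) : N ⊗ M :=
  tlift (fun m n => n ⊗ m) t.

Section TensorMaps.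
Variables (K : fieldType).

Lemma linD (M N : lmodType K) (f : M -> N) : linear f -> {morph f : x y / x + y}.
Proof. by move=> fl x y; have := fl 1 x y; rewrite !scale1r. Qed.
Lemma lin0 (M N : lmodType K) (f : M -> N) : linear f -> f 0 = 0.
Proof. by move=> fl; have := fl (-1) 0 0; rewrite scaler0 addr0 scaleN1r addNr. Qed.
Lemma linZ (M N : lmodType K) (f : M -> N) : linear f -> forall k x, f (k *: x) = k *: f x.
Proof. by move=> fl k x; have := fl k x 0; rewrite (lin0 fl) !addr0. Qed.

Lemma void_balanced (M N P : lmodType K) (g : M -> N -> P) :
  (forall n, linear (g^~ n)) -> (forall m, linear (g m)) ->
  balanced (void_act M) (void_act N) g.
Proof. by move=> gl gr; split=> // -[]. Qed.

Lemma tpure_linl (M N : lmodType K) I (r : I -> M -> M) (l : I -> N -> N) n :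
  linear (fun m => m ⊗ n : tens r l).
Proof. exact: (bal_l (tpure_balanced r l)). Qed.

Lemma tpure_linr (M N : lmodType K) I (r : I -> M -> M) (l : I -> N -> N) m :
  linear (fun n => m ⊗ n : tens r l).
Proof. exact: (bal_r (tpure_balanced r l)). Qed.

Section Tmap.
Variables (M N M' N' : lmodType K) (I J : Type).
Variables (r : I -> M -> M) (l : I -> N -> N) (r' : J -> M' -> M') (l' : J -> N' -> N').
Variables (f : M -> M') (g : N -> N').
Hypotheses (fl : linear f) (gl : linear g).
Hypothesis fg : forall i m n, f (r i m) ⊗ g n = f m ⊗ g (l i n) :> tens r' l'.

Fact tmap_balanced : balanced r l (fun m n => f m ⊗ g n : tens r' l').
Proof.
split=> [n k x y|m k x y|]; last exact: fg.
- by rewrite fl tpure_linl.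
- by rewrite gl tpure_linr.
Qed.

Lemma tmapE m n : tmap f g (m ⊗ n : tens r l) = f m ⊗ g n :> tens r' l'.
Proof. exact: tliftE tmap_balanced _ _. Qed.

Lemma tmap_linear : linear (tmap f g : tens r l -> tens r' l').
Proof. exact: tlift_linear tmap_balanced. Qed.
End Tmap.

Lemma tmapvE (M N M' N' : lmodType K) (f : M -> M') (g : N -> N') m n :
  linear f -> linear g -> tmap f g (m ⊗ n : M ⊗ N) = f m ⊗ g n :> M' ⊗ N'.
Proof. by move=> fl gl; apply: tmapE => // -[]. Qed.

Lemma tmapv_linear (M N M' N' : lmodType K) (f : M -> M') (g : N -> N') :
  linear f -> linear g -> linear (tmap f g : M ⊗ N -> M' ⊗ N').
Proof. by move=> fl gl; apply: tmap_linear => // -[]. Qed.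

Lemma tswap_balanced (M N : lmodType K) :
  balanced (void_act M) (void_act N) (fun m n => n ⊗ m : N ⊗ M).
Proof.
by apply: void_balanced => [n|m] k x y; rewrite (tpure_linl, tpure_linr).
Qed.

Lemma tswapE (M N : lmodType K) (m : M) (n : N) : tswap (m ⊗ n) = n ⊗ m.
Proof. exact: tliftE (tswap_balanced M N) _ _. Qed.

Lemma tswap_linear (M N : lmodType K) : linear (@tswap K M N).
Proof. exact: tlift_linear (tswap_balanced M N). Qed.

Lemma id_linear (M : lmodType K) : linear (@id M).
Proof. by []. Qed.
End TensorMaps.
#[global] Hint Resolve id_linear : core.

Section Modules.
Variable (K : fieldType).

Record is_act (B : algType K) (V : lmodType K) (act : B -> V -> V) : Prop := IsAct {
  act_linl : forall v, linear (act^~ v);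
  act_linr : forall b, linear (act b);
  act_1 : forall v, act 1 v = v;
  act_M : forall a b v, act (a * b) v = act a (act b v) }.

Variable (B : algType K).

(* Left modules and bimodules over the K-algebra B, with their K-space structure;
   a right action of B is a left action of the converse algebra. *)
Record lmod := Lmod {
  lm_sort :> lmodType K;
  lm_act : B -> lm_sort -> lm_sort;
  lm_actP : is_act lm_act }.

Record bimod := Bimod {
  bm_sort :> lmodType K;
  bm_l : B -> bm_sort -> bm_sort;
  bm_r : bm_sort -> B -> bm_sort;
  bm_lP : is_act bm_l;
  bm_rP : is_act (fun (b : B^c) m => bm_r m b);
  bm_lr : forall a m b, bm_r (bm_l a m) b = bm_l a (bm_r m b) }.

Definition lmod_of_bimod (M : bimod) : lmod := Lmod (bm_lP M).
End Modules.

Notation "b • m" := (lm_act b m) : ring_scope.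
Notation "b ▷ m" := (bm_l b m) : ring_scope.
Notation "m ◁ b" := (bm_r m b) : ring_scope.

Section Actions.
Variables (K : fieldType) (B : algType K).

Fact mull_act : is_act (fun b x : B => b * x).
Proof.
split=> [x k a b|b k x y|x|a b x]; rewrite ?mul1r ?mulrA //.
- by rewrite mulrDl scalerAl.
- by rewrite mulrDr scalerAr.
Qed.

Fact mulr_act : is_act (fun (b : B^c) (x : B) => x * b).
Proof.
split=> [x k a b|b k x y|x|a b x].
- by rewrite mulrDr -scalerAr.
- by rewrite mulrDl -scalerAl.
- exact: mulr1.
- exact: mulrA.
Qed.

Section TensAct.
Variables (M N : lmodType K) (I : Type) (r : I -> M -> M) (l : I -> N -> N).

Fact tensl_act (act : B -> M -> M) : is_act act ->
    (forall i b m, r i (act b m) = act b (r i m)) ->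
  is_act (fun b => tmap (act b) id : tens r l -> tens r l).
Proof.
move=> [al ar a1 aM] com.
have E b m n : tmap (act b) id (m ⊗ n : tens r l) = act b m ⊗ n :> tens r l.
  by apply: tmapE => // i m' n'; rewrite -com tpureB.
have L b : linear (tmap (act b) id : tens r l -> tens r l).
  by apply: tmap_linear => // i m' n'; rewrite -com tpureB.
split=> // [t k a b|t|a b t]; elim/tens_ind: t => [m n|s t Es Et].
- by rewrite !E al tpure_linl.
- by rewrite !(linD (L _)) Es Et scalerDr addrACA.
- by rewrite E a1.
- by rewrite (linD (L _)) Es Et.
- by rewrite !E aM.
- by rewrite !(linD (L _)) Es Et.
Qed.

Fact tensr_act (act : B -> N -> N) : is_act act ->
    (forall i b n, l i (act b n) = act b (l i n)) ->
  is_act (fun b => tmap id (act b) : tens r l -> tens r l).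
Proof.
move=> [al ar a1 aM] com.
have E b m n : tmap id (act b) (m ⊗ n : tens r l) = m ⊗ act b n :> tens r l.
  by apply: tmapE => // i m' n'; rewrite -com tpureB.
have L b : linear (tmap id (act b) : tens r l -> tens r l).
  by apply: tmap_linear => // i m' n'; rewrite -com tpureB.
split=> // [t k a b|t|a b t]; elim/tens_ind: t => [m n|s t Es Et].
- by rewrite !E al tpure_linr.
- by rewrite !(linD (L _)) Es Et scalerDr addrACA.
- by rewrite E a1.
- by rewrite (linD (L _)) Es Et.
- by rewrite !E aM.
- by rewrite !(linD (L _)) Es Et.
Qed.
End TensAct.

Fact prod_act (M N : lmodType K) (f : B -> M -> M) (g : B -> N -> N) :
  is_act f -> is_act g ->
  is_act (fun b (p : (M * N)%type) => (f b p.1, g b p.2) : (M * N)%type).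
Proof.
move=> [fl fr f1 fM] [gl gr g1 gM].
split=> [p k a b|b k p q|[m n]|a b p] /=; rewrite ?f1 ?g1 ?fM ?gM //.
- by rewrite fl gl.
- by rewrite fr gr.
Qed.
End Actions.

Section Env.
Variables (K : fieldType) (A : algType K).

Definition env : Type := A ⊗ A^c.
HB.instance Definition _ := GRing.Lmodule.on env.

Definition env1 : env := (1 : A) ⊗ (1 : A^c).
Definition env_mul (s t : env) : env :=
  tlift (fun (a : A) (b : A^c) =>
    tlift (fun (c : A) (d : A^c) => (a * c) ⊗ (b * d) : env) t) s.

Let in_bal (a : A) (b : A^c) :
  balanced (void_act A) (void_act A^c)
    (fun (c : A) (d : A^c) => (a * c) ⊗ (b * d) : env).
Proof.
apply: void_balanced => [d|c] k x y.
- by rewrite mulrDr -scalerAr tpure_linl.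
- by rewrite mulrDr -scalerAr tpure_linr.
Qed.

Let in_lin a b := tlift_linear (in_bal a b).

Let out_bal (t : env) :
  balanced (void_act A) (void_act A^c) (fun (a : A) (b : A^c) =>
    tlift (fun (c : A) (d : A^c) => (a * c) ⊗ (b * d) : env) t).
Proof.
apply: void_balanced => [b|a] k x y; elim/tens_ind: t => [c d|s t Es Et].
- by rewrite !(tliftE (in_bal _ _)) mulrDl -scalerAl tpure_linl.
- by rewrite !(linD (in_lin _ _)) Es Et scalerDr addrACA.
- by rewrite !(tliftE (in_bal _ _)) mulrDl -scalerAl tpure_linr.
- by rewrite !(linD (in_lin _ _)) Es Et scalerDr addrACA.
Qed.

Lemma env_mulE (a c : A) (b d : A^c) :
  env_mul (a ⊗ b) (c ⊗ d) = (a * c) ⊗ (b * d).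
Proof. by rewrite /env_mul (tliftE (out_bal _)) (tliftE (in_bal _ _)). Qed.

Fact env_mul_linl t : linear (env_mul^~ t).
Proof. exact: tlift_linear (out_bal t). Qed.

Fact env_mul_linr s : linear (env_mul s).
Proof.
move=> k x y; elim/tens_ind: s => [a b|s t Es Et].
  by rewrite /env_mul !(tliftE (out_bal _)) (in_lin a b).
by rewrite !(linD (env_mul_linl _)) Es Et scalerDr addrACA.
Qed.

Fact env_mulA : associative env_mul.
Proof.
move=> s t u; elim/tens_ind: s => [a b|s s' E E']; last first.
  by rewrite !(linD (env_mul_linl _)) E E'.
elim/tens_ind: t => [c d|t t' E E']; last first.
  by rewrite (linD (env_mul_linl _)) !(linD (env_mul_linr _)) (linD (env_mul_linl _)) E E'.
elim/tens_ind: u => [e f|u u' E E']; last by rewrite !(linD (env_mul_linr _)) E E'.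
by rewrite !env_mulE !mulrA.
Qed.

Fact env_mul1l : left_id env1 env_mul.
Proof.
move=> t; elim/tens_ind: t => [a b|s t E E']; first by rewrite env_mulE !mul1r.
by rewrite (linD (env_mul_linr _)) E E'.
Qed.

Fact env_mul1r : right_id env1 env_mul.
Proof.
move=> t; elim/tens_ind: t => [a b|s t E E']; first by rewrite env_mulE !mulr1.
by rewrite (linD (env_mul_linl _)) E E'.
Qed.

Fact env_mulDl : left_distributive env_mul +%R.
Proof. by move=> s t u; rewrite (linD (env_mul_linl _)). Qed.
Fact env_mulDr : right_distributive env_mul +%R.
Proof. by move=> s t u; rewrite (linD (env_mul_linr _)). Qed.

Fact env1_neq0 : env1 != 0.
Proof.
have bal : balanced (void_act A) (void_act A^c) (fun (a : A) (b : A^c) => a * (b : A)).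
  apply: void_balanced => [b|a] k x y.
  - by rewrite mulrDl scalerAl.
  - by rewrite [LHS]mulrDr scalerAr.
apply/eqP => /(congr1 (tlift (fun (a : A) (b : A^c) => a * (b : A)))).
rewrite (lin0 (tlift_linear bal)) (tliftE bal) mulr1; apply/eqP.
exact: oner_neq0.
Qed.

HB.instance Definition _ := GRing.Zmodule_isNzRing.Build env
  env_mulA env_mul1l env_mul1r env_mulDl env_mulDr env1_neq0.

Fact env_scaleAl (k : K) (s t : env) : k *: (s * t) = (k *: s) * t.
Proof. by rewrite [RHS](linZ (env_mul_linl t)). Qed.
HB.instance Definition _ := GRing.Lmodule_isLalgebra.Build K env env_scaleAl.

Fact env_scaleAr (k : K) (s t : env) : k *: (s * t) = s * (k *: t).
Proof. by rewrite [RHS](linZ (env_mul_linr s)). Qed.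
HB.instance Definition _ := GRing.Lalgebra_isAlgebra.Build K env env_scaleAr.

Lemma envM (a c : A) (b d : A^c) :
  (a ⊗ b : env) * (c ⊗ d : env) = (a * c) ⊗ (b * d) :> env.
Proof. exact: env_mulE. Qed.

(* The subalgebra S^e of A^e, i.e. the image of S ⊗ S^op. *)
Definition env_sub (S : {pred A}) : {pred env} :=
  spanb (fun t : env => exists s s' : A, [/\ s \in S, s' \in S & t = s ⊗ (s' : A^c)]).

Section EnvAct.
Variables (V : lmodType K) (f : A -> V -> V) (g : A^c -> V -> V).

Definition env_act (t : env) (v : V) : V := tlift (fun (a : A) (b : A^c) => f a (g b v)) t.

Section Theory.
Hypotheses (fl : forall v, linear (f^~ v)) (fr : forall a, linear (f a)).
Hypotheses (gl : forall v, linear (g^~ v)) (gr : forall b, linear (g b)).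

Fact env_act_balanced v :
  balanced (void_act A) (void_act A^c) (fun (a : A) (b : A^c) => f a (g b v)).
Proof.
apply: void_balanced => [b|a] k x y; first by rewrite fl.
by rewrite gl fr.
Qed.

Lemma env_actE (a : A) (b : A^c) v : env_act (a ⊗ b) v = f a (g b v).
Proof. exact: tliftE (env_act_balanced v) _ _. Qed.

Lemma env_act_linl v : linear (env_act^~ v).
Proof. exact: tlift_linear (env_act_balanced v). Qed.

Lemma env_act_linr t : linear (env_act t).
Proof.
move=> k x y; elim/tens_ind: t => [a b|s t E E'].
  by rewrite !env_actE gr fr.
by rewrite !(linD (env_act_linl _)) E E' scalerDr addrACA.
Qed.
End Theory.

Fact env_actP : is_act f -> is_act g ->
  (forall a b v, g b (f a v) = f a (g b v)) -> is_act env_act.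
Proof.
move=> [fl fr f1 fM] [gl gr g1 gM] com.
have E := env_actE fl fr gl; have L := env_act_linl fl fr gl.
have R := env_act_linr fl fr gl gr.
split=> // [v|s t v]; first by rewrite E f1 g1.
elim/tens_ind: s => [a b|s s' Es Es']; last first.
  by rewrite mulrDl !(linD (L _)) Es Es'.
elim/tens_ind: t => [c d|t t' Et Et']; last first.
  by rewrite mulrDr !(linD (L _)) (linD (R _)) Et Et'.
by rewrite envM !E fM gM com.
Qed.
End EnvAct.

Fact env_ractP (V : lmodType K) (f : A -> V -> V) (g : A^c -> V -> V) :
  is_act (f : A^c -> V -> V) -> is_act (g : (A^c)^c -> V -> V) ->
  (forall a b v, g b (f a v) = f a (g b v)) -> is_act (env_act f g : env^c -> V -> V).
Proof.
move=> [fl fr f1 fM] [gl gr g1 gM] com.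
have E := env_actE fl fr gl; have L := env_act_linl fl fr gl.
have R := env_act_linr fl fr gl gr.
split=> // [v|s t v]; first by rewrite E f1 g1.
elim/tens_ind: s => [a b|s s' Es Es']; last first.
  by rewrite [_ * t](mulrDr (t : env)) !(linD (L _)) Es Es'.
elim/tens_ind: t => [c d|t t' Et Et']; last first.
  by rewrite [_ * _](mulrDl (t : env)) !(linD (L _)) (linD (R _)) Et Et'.
rewrite [_ * _](envM c a d b) !E.
by rewrite [f (c * a) _](fM a c) [g (d * b) _](gM b d) com.
Qed.

(* An A-bimodule is a left A^e-module by (a ⊗ b) m = a m b. *)
Fact bimod_env_act (M : bimod A) :
  is_act (env_act (fun (a : A) (m : M) => a ▷ m) (fun (b : A^c) (m : M) => m ◁ b)).
Proof. by apply: env_actP (bm_lP M) (bm_rP M) _ => a b v; rewrite bm_lr. Qed.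

Definition bimod_env (M : bimod A) : lmod env := Lmod (bimod_env_act M).
End Env.

Section Bimodules.
Variables (K : fieldType) (B : algType K).

Fact reg_lr (a m b : B) : a * m * b = a * (m * b).
Proof. by rewrite mulrA. Qed.
Definition reg : bimod B := @Bimod K B B *%R *%R (mull_act B) (mulr_act B) reg_lr.

(* B acting on the left-hand factor of B ⊗ V. *)
Section LeftFactor.
Variable (V : lmodType K).

Fact tensfst_lP : is_act (fun b => tmap ( *%R b) id : B ⊗ V -> B ⊗ V).
Proof. by apply: tensl_act (mull_act B) _ => -[]. Qed.
Fact tensfst_rP : is_act (fun b : B^c => tmap (fun x : B => x * b) id : B ⊗ V -> B ⊗ V).
Proof. by apply: tensl_act (mulr_act B) _ => -[]. Qed.
Fact tensfst_lr a (m : B ⊗ V) b :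
  tmap (fun x : B => x * b) id (tmap ( *%R a) id m : B ⊗ V) =
  tmap ( *%R a) id (tmap (fun x : B => x * b) id m : B ⊗ V) :> B ⊗ V.
Proof.
have L := act_linr tensfst_lP; have R := act_linr tensfst_rP.
elim/tens_ind: m => [m v|s t Es Et].
  by rewrite !tmapvE ?mulrA //; do ?exact: (act_linr (mull_act B));
    do ?exact: (act_linr (mulr_act B)).
by rewrite (linD (L _)) !(linD (R _)) (linD (L _)) Es Et.
Qed.
Definition tensfst : bimod B := Bimod tensfst_lP tensfst_rP tensfst_lr.
End LeftFactor.

(* B ⊗_R B for R a subset of B, with its outer bimodule structure. *)
Section OverSub.
Variable (R : {pred B}).

Definition tens_sub : Type :=
  tens (fun (s : {s : B | s \in R}) (x : B) => x * val s)
       (fun (s : {s : B | s \in R}) (y : B) => val s * y).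
HB.instance Definition _ := GRing.Lmodule.on tens_sub.

Fact outer_lP : is_act (fun b => tmap ( *%R b) id : tens_sub -> tens_sub).
Proof. by apply: tensl_act (mull_act B) _ => i b m; rewrite mulrA. Qed.
Fact outer_rP : is_act (fun b : B^c => tmap id (fun x : B => x * b) : tens_sub -> tens_sub).
Proof. by apply: tensr_act (mulr_act B) _ => i b m; rewrite mulrA. Qed.

Let mull_lin (b : B) : linear ( *%R b) := act_linr (mull_act B) b.
Let mulr_lin (b : B) : linear (fun x : B => x * b) := act_linr (mulr_act B) b.

Lemma outer_lE b x y : tmap ( *%R b) id (x ⊗ y : tens_sub) = (b * x) ⊗ y :> tens_sub.
Proof.
apply: tmapE => // i m n; rewrite mulrA.
exact: tpureB.
Qed.
Lemma outer_rE b x y : tmap id (fun x : B => x * b) (x ⊗ y : tens_sub) = x ⊗ (y * b) :> tens_sub.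
Proof.
apply: tmapE => // i m n; rewrite -mulrA.
exact: tpureB.
Qed.

Fact outer_lr a (m : tens_sub) b :
  tmap id (fun x : B => x * b) (tmap ( *%R a) id m : tens_sub) =
  tmap ( *%R a) id (tmap id (fun x : B => x * b) m : tens_sub) :> tens_sub.
Proof.
have L := act_linr outer_lP; have R' := act_linr outer_rP.
elim/tens_ind: m => [x y|s t Es Et]; first by rewrite !(outer_lE, outer_rE).
by rewrite (linD (L _)) !(linD (R' _)) (linD (L _)) Es Et.
Qed.
Definition outer_sub : bimod B := Bimod outer_lP outer_rP outer_lr.

Definition tmult : tens_sub -> B := tlift *%R.

Fact tmult_balanced : balanced (fun (s : {s : B | s \in R}) (x : B) => x * val s)
  (fun (s : {s : B | s \in R}) (y : B) => val s * y) ( *%R : B -> B -> B).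
Proof. by split=> [b|b|i x y]; [exact: mulr_lin|exact: mull_lin|rewrite mulrA]. Qed.

Lemma tmultE x y : tmult (x ⊗ y) = x * y.
Proof. exact: tliftE tmult_balanced _ _. Qed.
Lemma tmult_linear : linear tmult.
Proof. exact: tlift_linear tmult_balanced. Qed.

Definition Omega_pred : {pred tens_sub} := [pred t | tmult t == 0].
Fact Omega_submod : submod_closed Omega_pred.
Proof.
split=> [|k x y]; rewrite !inE ?(lin0 tmult_linear) // tmult_linear.
by move=> /eqP-> /eqP->; rewrite scaler0 addr0.
Qed.
HB.instance Definition _ :=
  GRing.isSubmodClosed.Build K tens_sub Omega_pred Omega_submod.

Record Omega := MkOmega { Omega_val :> tens_sub; Omega_valP : Omega_val \in Omega_pred }.
HB.instance Definition _ := [isSub for Omega_val].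
HB.instance Definition _ := [Choice of Omega by <:].
HB.instance Definition _ := [SubChoice_isSubLmodule of Omega by <:].

Fact tmult_l b (t : tens_sub) : tmult (tmap ( *%R b) id t : tens_sub) = b * tmult t.
Proof.
elim/tens_ind: t => [x y|s t Es Et]; first by rewrite outer_lE !tmultE mulrA.
by rewrite (linD (act_linr outer_lP b)) !(linD tmult_linear) Es Et mulrDr.
Qed.
Fact tmult_r b (t : tens_sub) : tmult (tmap id (fun x : B => x * b) t : tens_sub) = tmult t * b.
Proof.
elim/tens_ind: t => [x y|s t Es Et]; first by rewrite outer_rE !tmultE mulrA.
by rewrite (linD (act_linr outer_rP b)) !(linD tmult_linear) Es Et mulrDl.
Qed.

Fact Omega_l_closed b (w : Omega) : (tmap ( *%R b) id (Omega_val w) : tens_sub) \in Omega_pred.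
Proof. by rewrite inE tmult_l (eqP (Omega_valP w)) mulr0. Qed.
Fact Omega_r_closed b (w : Omega) : (tmap id (fun x : B => x * b) (Omega_val w) : tens_sub) \in Omega_pred.
Proof. by rewrite inE tmult_r (eqP (Omega_valP w)) mul0r. Qed.

Definition Omega_l b w : Omega := MkOmega (Omega_l_closed b w).
Definition Omega_r w b : Omega := MkOmega (Omega_r_closed b w).

Fact Omega_lP : is_act Omega_l.
Proof.
have [al ar a1 aM] := outer_lP.
split=> [w k a b|b k v w|w|a b w]; apply: val_inj => /=; [exact: al|exact: ar|exact: a1|exact: aM].
Qed.
Fact Omega_rP : is_act (fun b : B^c => Omega_r^~ b).
Proof.
have [al ar a1 aM] := outer_rP.
split=> [w k a b|b k v w|w|a b w]; apply: val_inj => /=; [exact: al|exact: ar|exact: a1|exact: aM].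
Qed.
Fact Omega_lr a w b : Omega_r (Omega_l a w) b = Omega_l a (Omega_r w b).
Proof. by apply: val_inj; apply: outer_lr. Qed.
Definition Omegabm : bimod B := Bimod Omega_lP Omega_rP Omega_lr.

Fact d_closed b : (1 ⊗ b - b ⊗ 1 : tens_sub) \in Omega_pred.
Proof.
by rewrite inE -scaleN1r addrC tmult_linear !tmultE mulr1 mul1r scaleN1r addNr.
Qed.
Definition dOm (b : B) : Omega := MkOmega (d_closed b).
End OverSub.

(* The map Omega^1_R B -> P determined by b0 d b1 |-> g b0 b1, for g bilinear and
   R-balanced with g b 1 = 0: an element Σ x ⊗ y of the kernel equals Σ x d y. *)
Definition Omega_lift (R : {pred B}) (P : lmodType K) (g : B -> B -> P)
  (w : Omega R) : P := tlift g (Omega_val w).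

End Bimodules.

Section Derivations.
Variables (K : fieldType) (B : algType K) (R : {pred B}).

Record is_der (M : bimod B) (f : B -> M) : Prop := IsDer {
  der_lin : linear f;
  der_mul : forall a b, f (a * b) = f a ◁ b + a ▷ f b;
  der_sub : forall s, s \in R -> f s = 0 }.

Definition iOm (M : bimod B) (f : B -> M) : Omega R -> M :=
  Omega_lift (fun x y => x ▷ f y).

Lemma iOm_balanced (M : bimod B) (f : B -> M) : is_der f ->
  balanced (fun (s : {s : B | s \in R}) (x : B) => x * val s)
           (fun (s : {s : B | s \in R}) (y : B) => val s * y) (fun x y => x ▷ f y).
Proof.
move=> [fl fM fS]; split=> [y|x k y z|[s Rs] x y] /=.
- exact: act_linl (bm_lP M) _.
- by rewrite fl (act_linr (bm_lP M)).
- by rewrite fM (fS _ Rs) (lin0 (act_linr (bm_rP M) y)) add0r (act_M (bm_lP M)).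
Qed.
End Derivations.

Section LeftModules.
Variables (K : fieldType) (B : algType K).

Record is_lhom (N P : lmod B) (f : N -> P) : Prop := IsLhom {
  lhom_lin : linear f;
  lhom_act : forall b n, f (b • n) = b • f n }.

Definition fin_gen (N : lmod B) : Prop :=
  exists (n : nat) (g : 'I_n -> N),
    forall x, exists c : 'I_n -> B, x = \sum_i c i • g i.

Definition projective (N : lmod B) : Prop :=
  forall (P Q : lmod B) (p : P -> Q) (f : N -> Q),
    is_lhom p -> (forall q, exists x, p x = q) -> is_lhom f ->
  exists2 h : N -> P, is_lhom h & forall x, p (h x) = f x.

(* M ⊗_B N *)
Section ModTens.
Variables (M : bimod B) (N : lmod B).

Definition modtens_sort : Type :=
  tens (fun (b : B) (m : M) => m ◁ b) (fun (b : B) (n : N) => b • n).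
HB.instance Definition _ := GRing.Lmodule.on modtens_sort.

Fact modtens_act :
  is_act (fun b : B => tmap (fun m : M => b ▷ m) id : modtens_sort -> modtens_sort).
Proof. by apply: tensl_act (bm_lP M) _ => b c m; rewrite bm_lr. Qed.

Definition modtens : lmod B := Lmod modtens_act.
End ModTens.

Definition is_connection (R : {pred B}) (N : lmod B)
    (nabla : N -> modtens (Omegabm R) N) : Prop :=
  linear nabla /\
  forall b n, nabla (b • n) = (dOm R b ⊗ n : modtens (Omegabm R) N) + b • nabla n.

(* |M| = M / <bm - mb> *)
Definition comm_rel (M : bimod B) (x : M) : Prop :=
  exists (b : B) (m : M), x = b ▷ m - m ◁ b.
Definition tr (M : bimod B) : Type := qmod (@comm_rel M).
HB.instance Definition _ (M : bimod B) := GRing.Lmodule.on (tr M).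
Definition trcl (M : bimod B) (m : M) : tr M := qcl (@comm_rel M) m.

(* N^* = Hom_B(N, B), a right B-module by (θ b)(n) = θ(n) b *)
Section Dual.
Variable (N : lmod B).

Definition dual_pred : {pred N -> B} :=
  [pred f | `[< @is_lhom N (lmod_of_bimod (reg B)) f >]].
Lemma dual_predP f : reflect (@is_lhom N (lmod_of_bimod (reg B)) f) (f \in dual_pred).
Proof. exact: asboolP. Qed.
Fact dual_submod : submod_closed dual_pred.
Proof.
split=> [|k f g].
  by apply/dual_predP; split=> [c x y|b n] /=; rewrite ?scaler0 ?addr0 ?mulr0.
move=> /dual_predP[fl fa] /dual_predP[gl ga]; apply/dual_predP; split=> [c x y|b n] /=.
- rewrite !fctE /= fl gl !scalerDr !scalerA [k * c]mulrC.
  by rewrite addrACA.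
- by rewrite !fctE /= fa ga /= mulrDr scalerAr.
Qed.
HB.instance Definition _ := GRing.isSubmodClosed.Build K (N -> B) dual_pred dual_submod.

Record dual := MkDual { dual_val :> N -> B; dual_valP : dual_val \in dual_pred }.
HB.instance Definition _ := [isSub for dual_val].
HB.instance Definition _ := [Choice of dual by <:].
HB.instance Definition _ := [SubChoice_isSubLmodule of dual by <:].

Fact dual_r_closed (th : dual) (b : B) : (fun n => th n * b) \in dual_pred.
Proof.
have /dual_predP[tl ta] := dual_valP th.
apply/dual_predP; split=> [c x y|a n] /=.
- by rewrite tl mulrDl -scalerAl.
- by rewrite ta /= mulrA.
Qed.
Definition dual_r (b : B) (th : dual) : dual := MkDual (dual_r_closed th b).
End Dual.

(* Tr is the inverse of the canonical map
     N^* ⊗_B M ⊗_B N -> Hom_B(N, M ⊗_B N), θ ⊗ m ⊗ n |-> (x |-> θ(x) m ⊗ n),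
   (bijective for N finitely generated projective), followed by the contraction
   θ ⊗ m ⊗ n |-> |θ(n) m|. *)
Section Trace.
Variables (N : lmod B) (M : bimod B).

Definition dual_tens : Type :=
  tens (@dual_r N) (fun (b : B) (t : modtens M N) => b • t).
HB.instance Definition _ := GRing.Lmodule.on dual_tens.

Definition dual_hom (u : dual_tens) (x : N) : modtens M N :=
  tlift (fun (th : dual N) (t : modtens M N) => th x • t) u.

Definition contract (u : dual_tens) : tr M :=
  tlift (fun (th : dual N) (t : modtens M N) =>
    tlift (fun (m : M) (n : N) => trcl (th n ▷ m)) t) u.

Definition Tr (phi : N -> modtens M N) : tr M :=
  contract (xget 0 [set u : dual_tens | forall x, dual_hom u x = phi x]).
End Trace.
End LeftModules.

Section DoubleBrackets.
Variables (K : fieldType) (A : algType K).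

Let mull_lin (b : A) : linear (fun x : A => b * x) := act_linr (mull_act A) b.
Let mulr_lin (b : A) : linear (fun x : A => x * b) := act_linr (mulr_act A) b.

Fact outer_tens_lP : is_act (fun b : A => tmap (fun x : A => b * x) id : A ⊗ A -> A ⊗ A).
Proof. by apply: tensl_act (mull_act A) _ => -[]. Qed.
Fact outer_tens_rP : is_act (fun b : A^c => tmap id (fun x : A => x * b) : A ⊗ A -> A ⊗ A).
Proof. by apply: tensr_act (mulr_act A) _ => -[]. Qed.
Fact outer_tens_lr a (m : A ⊗ A) b :
  tmap id (fun x : A => x * b) (tmap (fun x : A => a * x) id m : A ⊗ A) =
  tmap (fun x : A => a * x) id (tmap id (fun x : A => x * b) m : A ⊗ A) :> A ⊗ A.
Proof.
have L := act_linr outer_tens_lP; have R := act_linr outer_tens_rP.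
elim/tens_ind: m => [x y|s t Es Et].
  by rewrite !(tmapvE _ _ (mull_lin _) (@id_linear _ _)) !(tmapvE _ _ (@id_linear _ _) (mulr_lin _))
             !(tmapvE _ _ (mull_lin _) (@id_linear _ _)).
by rewrite (linD (L _)) !(linD (R _)) (linD (L _)) Es Et.
Qed.
Definition outer : bimod A := Bimod outer_tens_lP outer_tens_rP outer_tens_lr.

Definition inner_l (x : A) (t : A ⊗ A) : A ⊗ A := tmap id (fun b : A => x * b) t.
Definition inner_r (t : A ⊗ A) (y : A) : A ⊗ A := tmap (fun a : A => a * y) id t.

Definition multA : A ⊗ A -> A := tlift (fun a b : A => a * b).

Definition ad (M : bimod A) (m : M) (a : A) : M := a ▷ m - m ◁ a.

(* (a · Θ · b)(x) = Θ'(x) b ⊗ a Θ''(x) *)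
Definition dder_act (a : A) (Th : A -> A ⊗ A) (b : A) : A -> A ⊗ A :=
  fun x => inner_r (inner_l a (Th x)) b.
Definition ad_dder (Th : A -> A ⊗ A) (a : A) : A -> A ⊗ A :=
  dder_act a Th 1 - dder_act 1 Th a.

Variable S : {pred A}.

Record is_double_bracket (Pi : A ⊗ A -> A ⊗ A) : Prop := IsDoubleBracket {
  db_lin : linear Pi;
  db_mulr : forall a b c : A,
    Pi (a ⊗ (b * c)) = (Pi (a ⊗ b) : outer) ◁ c + b ▷ (Pi (a ⊗ c) : outer);
  db_mull : forall a b c : A,
    Pi ((a * b) ⊗ c) = inner_r (Pi (a ⊗ c)) b + inner_l a (Pi (b ⊗ c));
  db_subr : forall a s : A, s \in S -> Pi (a ⊗ s) = 0;
  db_subl : forall a s : A, s \in S -> Pi (s ⊗ a) = 0 }.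

(* Π° *)
Definition dbop (Pi : A ⊗ A -> A ⊗ A) (t : A ⊗ A) : A ⊗ A := tswap (Pi (tswap t)).

Definition trA : Type := tr (reg A).
HB.instance Definition _ := GRing.Lmodule.on trA.

Definition Ham (Pi : A ⊗ A -> A ⊗ A) : trA -> A -> A :=
  qlift (fun a x : A => multA (Pi (a ⊗ x))).

(* Ω^1_S A as a left A^e-module *)
Definition OmegaE : lmod (env A) := bimod_env (Omegabm S).

Definition relatively_formally_smooth : Prop := fin_gen OmegaE /\ projective OmegaE.

Section Divergences.
Variable nabla : OmegaE -> modtens (Omegabm (env_sub S)) OmegaE.

Definition der_env (f : A -> A) : env A -> reg (env A) :=
  tlift (fun (a : A) (b : A^c) => f a ⊗ b + a ⊗ (f b : A^c) : env A).

Definition Lie (f : A -> A) : Omegabm S -> Omegabm S :=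
  Omega_lift (fun x y : A => f x ▷ (dOm S y : Omegabm S) + x ▷ (dOm S (f y) : Omegabm S)).

Definition Div (f : A -> A) : tr (reg (env A)) :=
  Tr (fun w : OmegaE =>
    tmap (iOm (der_env f)) id (nabla w) - (1 : reg (env A)) ⊗ (Lie f w : OmegaE)
      : modtens (reg (env A)) OmegaE).

Definition trenv_iso : tr (reg (env A)) -> trA ⊗ trA :=
  qlift (tlift (fun (a : A) (b : A^c) => trcl (a : reg A) ⊗ trcl (b : reg A) : trA ⊗ trA)).

Definition delta (Pi : A ⊗ A -> A ⊗ A) (u : trA) : trA ⊗ trA :=
  trenv_iso (Div (Ham Pi u)).
End Divergences.
End DoubleBrackets.

Section TripleTensors.
Variables (K : fieldType) (U V W : lmodType K).

Definition map3l (f : U -> U) (g : V -> V) (h : W -> W) : (U ⊗ V) ⊗ W -> (U ⊗ V) ⊗ W :=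
  tmap (tmap f g : U ⊗ V -> U ⊗ V) h.
Definition map3r (f : U -> U) (g : V -> V) (h : W -> W) : U ⊗ (V ⊗ W) -> U ⊗ (V ⊗ W) :=
  tmap f (tmap g h : V ⊗ W -> V ⊗ W).

Section Theory.
Variables (f : U -> U) (g : V -> V) (h : W -> W).
Hypotheses (fl : linear f) (gl : linear g) (hl : linear h).

Lemma map3lE u v w : map3l f g h ((u ⊗ v : U ⊗ V) ⊗ w) = (f u ⊗ g v : U ⊗ V) ⊗ h w.
Proof. by rewrite /map3l tmapvE // ?tmapvE //; apply: tmapv_linear. Qed.
Lemma map3rE u v w : map3r f g h (u ⊗ (v ⊗ w : V ⊗ W)) = f u ⊗ (g v ⊗ h w : V ⊗ W).
Proof. by rewrite /map3r tmapvE // ?tmapvE //; apply: tmapv_linear. Qed.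
Lemma map3l_linear : linear (map3l f g h).
Proof. by apply: tmapv_linear => //; apply: tmapv_linear. Qed.
Lemma map3r_linear : linear (map3r f g h).
Proof. by apply: tmapv_linear => //; apply: tmapv_linear. Qed.
End Theory.

Lemma tens3l_ind (Q : (U ⊗ V) ⊗ W -> Prop) :
  (forall u v w, Q ((u ⊗ v : U ⊗ V) ⊗ w)) -> (forall s t, Q s -> Q t -> Q (s + t)) ->
  forall t, Q t.
Proof.
move=> Q1 QD; apply: tens_ind => // s w; elim/tens_ind: s => // s t Qs Qt.
by rewrite tpureDl; apply: QD.
Qed.
Lemma tens3r_ind (Q : U ⊗ (V ⊗ W) -> Prop) :
  (forall u v w, Q (u ⊗ (v ⊗ w : V ⊗ W))) -> (forall s t, Q s -> Q t -> Q (s + t)) ->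
  forall t, Q t.
Proof.
move=> Q1 QD; apply: tens_ind => // u s; elim/tens_ind: s => // s t Qs Qt.
by rewrite tpureDr; apply: QD.
Qed.

Section Commute.
Variables (f f' : U -> U) (g g' : V -> V) (h h' : W -> W).
Hypotheses (fl : linear f) (gl : linear g) (hl : linear h).
Hypotheses (fl' : linear f') (gl' : linear g') (hl' : linear h').
Hypotheses (fC : forall x, f (f' x) = f' (f x)) (gC : forall x, g (g' x) = g' (g x)).
Hypotheses (hC : forall x, h (h' x) = h' (h x)).

Lemma map3l_comm t : map3l f g h (map3l f' g' h' t) = map3l f' g' h' (map3l f g h t).
Proof.
elim/tens3l_ind: t => [u v w|s t Es Et]; first by rewrite !map3lE // fC gC hC.
by rewrite !(linD (map3l_linear _ _ _)) // Es Et.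
Qed.
Lemma map3r_comm t : map3r f g h (map3r f' g' h' t) = map3r f' g' h' (map3r f g h t).
Proof.
elim/tens3r_ind: t => [u v w|s t Es Et]; first by rewrite !map3rE // fC gC hC.
by rewrite !(linD (map3r_linear _ _ _)) // Es Et.
Qed.
End Commute.
End TripleTensors.

Lemma env_act_comm (K : fieldType) (A : algType K) (V : lmodType K)
    (f f' : A -> V -> V) (g g' : A^c -> V -> V) :
    is_act f -> is_act g ->
    is_act (f' : A^c -> V -> V) -> is_act (g' : (A^c)^c -> V -> V) ->
    (forall a c v, f' c (f a v) = f a (f' c v)) -> (forall a c v, g' c (f a v) = f a (g' c v)) ->
    (forall a c v, f' c (g a v) = g a (f' c v)) -> (forall a c v, g' c (g a v) = g a (g' c v)) ->
  forall s v t, env_act f' g' t (env_act f g s v) = env_act f g s (env_act f' g' t v).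
Proof.
move=> [fl fr _ _] [gl gr _ _] [fl' fr' _ _] [gl' gr' _ _] ff gf fg gg s v t.
have L w : linear (fun t : env A => env_act f g t w) := env_act_linl fl fr gl w.
have R r : linear (@env_act K A V f g r) := env_act_linr fl fr gl gr r.
have L' w : linear (fun t : env A => env_act f' g' t w) := @env_act_linl K A V f' g' fl' fr' gl' w.
have R' r : linear (@env_act K A V f' g' r) := @env_act_linr K A V f' g' fl' fr' gl' gr' r.
have E0 := env_actE fl fr gl; have E0' := @env_actE K A V f' g' fl' fr' gl'.
elim/tens_ind: s => [a b|s s' E E']; last first.
  by rewrite !(linD (L _)) (linD (R' _)) E E'.
elim/tens_ind: t => [c d|t t' E E']; last first.
  by rewrite !(linD (L' _)) (linD (R _)) E E'.
by rewrite !E0 !E0' gf gg ff fg.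
Qed.

Section Trip.
Variables (K : fieldType) (A : algType K).

Definition trip_sort : Type := (((A ⊗ A) ⊗ A^c) * (A ⊗ (A^c ⊗ A^c)))%type.
HB.instance Definition _ := GRing.Lmodule.on trip_sort.

(* (a ⊗ \bar b) p = trip_la a (trip_lb b p) and p (a ⊗ \bar b) = trip_ra a (trip_rb b p);
   products of elements of A^c are taken in the opposite algebra. *)
Definition trip_la (a : A) (p : trip_sort) : trip_sort :=
  (map3l (fun x : A => a * x) id id p.1, map3r (fun x : A => a * x) id id p.2).
Definition trip_lb (b : A^c) (p : trip_sort) : trip_sort :=
  (map3l id id (fun z : A^c => b * z) p.1, map3r id (fun y : A^c => b * y) id p.2).
Definition trip_ra (a : A) (p : trip_sort) : trip_sort :=
  (map3l id (fun y : A => y * a) id p.1, map3r (fun x : A => x * a) id id p.2).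
Definition trip_rb (b : A^c) (p : trip_sort) : trip_sort :=
  (map3l id id (fun z : A^c => z * b) p.1, map3r id id (fun z : A^c => z * b) p.2).


Let tmap_id (U V : lmodType K) : tmap (@id U) (@id V) = id :> (U ⊗ V -> U ⊗ V).
Proof.
apply/funext; apply: tens_ext => // [|m n]; last by rewrite tmapvE.
exact: tmapv_linear.
Qed.

Fact trip_laP : is_act trip_la.
Proof.
apply: (@prod_act K A _ _ (fun a : A => map3l (fun x : A => a * x) (@id A) (@id A^c)) (fun a : A => map3r (fun x : A => a * x) (@id A^c) (@id A^c))).
- by apply: tensl_act => [|[]]; apply: tensl_act (mull_act A) _ => -[].
- rewrite /map3r tmap_id.
  by apply: tensl_act (mull_act A) _ => -[].
Qed.
Fact trip_lbP : is_act trip_lb.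
Proof.
apply: (@prod_act K A^c _ _ (fun a : A^c => map3l (@id A) (@id A) (fun x : A^c => a * x)) (fun a : A^c => map3r (@id A) (fun x : A^c => a * x) (@id A^c))).
- rewrite /map3l tmap_id.
  by apply: tensr_act (mull_act A^c) _ => -[].
- by apply: tensr_act => [|[]]; apply: tensl_act (mull_act A^c) _ => -[].
Qed.
Fact trip_raP : is_act (trip_ra : A^c -> trip_sort -> trip_sort).
Proof.
apply: (@prod_act K A^c _ _ (fun a : A^c => map3l (@id A) (fun x : A => x * a) (@id A^c)) (fun a : A^c => map3r (fun x : A => x * a) (@id A^c) (@id A^c))).
- by apply: tensl_act => [|[]]; apply: tensr_act (mulr_act A) _ => -[].
- rewrite /map3r tmap_id.
  by apply: tensl_act (mulr_act A) _ => -[].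
Qed.
Fact trip_rbP : is_act (trip_rb : (A^c)^c -> trip_sort -> trip_sort).
Proof.
apply: (@prod_act K (A^c)^c _ _ (fun a : (A^c)^c => map3l (@id A) (@id A) (fun x : A^c => x * a)) (fun a : (A^c)^c => map3r (@id A) (@id A^c) (fun x : A^c => x * a))).
- rewrite /map3l tmap_id.
  by apply: tensr_act (mulr_act A^c) _ => -[].
- by apply: tensr_act => [|[]]; apply: tensr_act (mulr_act A^c) _ => -[].
Qed.

Fact trip_lP : is_act (env_act trip_la trip_lb).
Proof.
apply: env_actP trip_laP trip_lbP _ => a b p.
have fl x := act_linr (mull_act A) x; have gl x := act_linr (mull_act A^c) x.
by congr (_, _); rewrite (map3l_comm, map3r_comm).
Qed.
Fact trip_rP : is_act (fun b : (env A)^c => env_act trip_ra trip_rb b).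
Proof.
apply: env_ractP trip_raP trip_rbP _ => a b p.
have fl x := act_linr (mulr_act A) x; have gl x := act_linr (mulr_act A^c) x.
by congr (_, _); rewrite (map3l_comm, map3r_comm).
Qed.
Fact trip_lr (s : env A) (p : trip_sort) (t : env A) :
  env_act trip_ra trip_rb t (env_act trip_la trip_lb s p) =
  env_act trip_la trip_lb s (env_act trip_ra trip_rb t p).
Proof.
have fl x := act_linr (mull_act A) x; have gl x := act_linr (mull_act A^c) x.
have fl' x := act_linr (mulr_act A) x; have gl' x := act_linr (mulr_act A^c) x.
apply: env_act_comm trip_laP trip_lbP trip_raP trip_rbP _ _ _ _ s p t => a c v;
  congr (_, _); rewrite (map3l_comm, map3r_comm) // => x; exact: (esym (mulrA _ _ _)).
Qed.

Definition trip : bimod (env A) :=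
  @Bimod K (env A) trip_sort (env_act trip_la trip_lb)
    (fun p t => env_act trip_ra trip_rb t p) trip_lP trip_rP trip_lr.
End Trip.

Section TripIso.
Variables (K : fieldType) (A : algType K).

Definition trip_iso (M : bimod A) (t : modtens (trip A) (bimod_env M)) :
    ((A ⊗ M) * (M ⊗ A))%type :=
  tlift (fun (p : trip A) (m : bimod_env M) =>
    (tlift (fun (xy : A ⊗ A) (z : A^c) =>
       tlift (fun x y : A => x ⊗ (y ▷ (m : M) ◁ (z : A)) : A ⊗ M) xy) p.1,
     tlift (fun (x : A) (yz : A^c ⊗ A^c) =>
       tlift (fun y z : A^c => (x ▷ (m : M) ◁ (z : A)) ⊗ (y : A) : M ⊗ A) yz) p.2)) t.

Definition trip_inv (M : bimod A) (q : ((A ⊗ M) * (M ⊗ A))%type) :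
    modtens (trip A) (bimod_env M) :=
  tlift (fun (x : A) (m : M) =>
    (((x ⊗ (1 : A) : A ⊗ A) ⊗ (1 : A^c), 0) : trip A) ⊗ (m : bimod_env M)
      : modtens (trip A) (bimod_env M)) q.1 +
  tlift (fun (m : M) (y : A) =>
    ((0, (1 : A) ⊗ ((y : A^c) ⊗ (1 : A^c) : A^c ⊗ A^c)) : trip A) ⊗ (m : bimod_env M)
      : modtens (trip A) (bimod_env M)) q.2.

Definition trtrip_iso : tr (trip A) -> ((A ⊗ trA A) * (trA A ⊗ A))%type :=
  qlift (fun p : trip A =>
    (tlift (fun (xy : A ⊗ A) (z : A^c) =>
       tlift (fun x y : A => (y * x) ⊗ trcl (z : reg A) : A ⊗ trA A) xy) p.1,
     tlift (fun (x : A) (yz : A^c ⊗ A^c) =>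
       tlift (fun y z : A^c => trcl (x : reg A) ⊗ ((y : A) * (z : A)) : trA A ⊗ A) yz) p.2)).
End TripIso.

Section Modular.
Variables (K : fieldType) (A : algType K) (S : {pred A}).
Variable nabla : OmegaE S -> modtens (Omegabm (env_sub S)) (OmegaE S).

Definition dder_op (Th : A -> A ⊗ A) (a : A^c) : A^c ⊗ A^c :=
  tlift (fun x y : A => (y : A^c) ⊗ (x : A^c) : A^c ⊗ A^c) (Th a).

Definition dder_env (Th : A -> A ⊗ A) : env A -> trip A :=
  tlift (fun (a : A) (b : A^c) => (Th a ⊗ b, a ⊗ dder_op Th b) : trip A).

Definition dLie (Th : A -> A ⊗ A) :
    Omegabm S -> ((A ⊗ Omegabm S) * (Omegabm S ⊗ A))%type :=
  Omega_lift (fun x y : A =>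
    (tmap id (fun z : A => z ▷ (dOm S y : Omegabm S)) (Th x)
       + tmap (fun z : A => x * z) (dOm S : A -> Omegabm S) (Th y) : A ⊗ Omegabm S,
     tmap (fun z : A => x ▷ (dOm S z : Omegabm S)) id (Th y) : Omegabm S ⊗ A)).

Definition TDiv (Th : A -> A ⊗ A) : tr (trip A) :=
  Tr (fun w : OmegaE S =>
    tmap (iOm (dder_env Th)) id (nabla w) - trip_inv (dLie Th w)
      : modtens (trip A) (OmegaE S)).

Definition phi (Pi : A ⊗ A -> A ⊗ A) (a : A) : tr (trip A) :=
  TDiv (fun x : A => Pi (a ⊗ x)).

Definition fd (q : ((A ⊗ trA A) * (trA A ⊗ A))%type) : A ⊗ trA A := q.1 + tswap q.2.

Definition modular (Pi : A ⊗ A -> A ⊗ A) (Th : A -> A ⊗ A) (a : A) : tensfst A (trA A) :=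
  fd (trtrip_iso (phi Pi a)) + tmap id (fun x : A => trcl (x : reg A)) (Th a).
End Modular.

(* |f| : |B| -> |M| *)
Definition trmap (K : fieldType) (B : algType K) (M : bimod B) (f : B -> M) :
    tr (reg B) -> tr M := qlift (fun b => trcl (f b)).

(* |A ⊗ V| ≅ |A| ⊗ V, A acting on the first factor *)
Definition trfst_iso (K : fieldType) (A : algType K) (V : lmodType K) :
    tr (tensfst A V) -> trA A ⊗ V :=
  qlift (tmap (fun x : A => trcl (x : reg A)) id).

Definition tr_modular (K : fieldType) (A : algType K) (S : {pred A})
    (nabla : OmegaE S -> modtens (Omegabm (env_sub S)) (OmegaE S))
    (Pi : A ⊗ A -> A ⊗ A) (Th : A -> A ⊗ A) (u : trA A) : trA A ⊗ trA A :=
  trfst_iso (trmap (modular nabla Pi Th) u).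

Definition sym (K : fieldType) (V : lmodType K) (t : V ⊗ V) : V ⊗ V := t + tswap t.

Definition skew_symmetric (K : fieldType) (V : lmodType K) (f : V -> V ⊗ V) : Prop :=
  forall u, sym (f u) = 0.

(* Main.v *)
Require Import Defs.
From mathcomp Require Import all_boot all_order all_algebra.
From mathcomp Require Import boolp classical_sets functions.

(* Multiplying out the two factors of trip(A) that carry the values of a double
   derivation is a map of A^e-bimodules trip(A) -> A^e.  It sends Θ^e to f^e and
   L_Θ to L_f for f = mult ∘ Θ, so naturality of the trace expresses Div(f)
   through TDiv(Θ).  Taking Θ = Π(a, -) and writing φ_1 + φ_2 for the components
   of φ(a) in (A ⊗ |A|) ⊕ (|A| ⊗ A), this gives δ(|a|) = |φ_1| + |φ_2|, whereas
   |m|(|a|) is |φ_1| + |φ_2| with the factors of |φ_2| exchanged, plus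
   |ae'| ⊗ |e''| - |e'| ⊗ |e''a|.  For symmetric e the last difference has the
   form t - t° and is killed by sym; hence sym ∘ δ = sym ∘ |m|. *)

(** [Tr] is defined through a chosen preimage in N^* ⊗ M ⊗ N, so nothing can be computed with it
    until that preimage is known to be unique. A dual basis of N gives uniqueness and an explicit
    sum, but a preimage exists only for a B-linear map. Naturality therefore requires the integrand
    of [TDiv] to be A^e-linear. Neither of its summands is: the connection term and L_Θ each obey a
    Leibniz rule, and the defects cancel because both are governed by the same derivation Θ^e. The
    Leibniz rule of L_Θ is awkward to verify on Ω^1 itself, a kernel with no induction on pure
    tensors of its own. The maps are therefore extended to A ⊗_S A, where pure tensors suffice. The
    price is that formulas for right multiplication acquire a correction depending on mult(t), which
    disappears on restriction to the kernel. *)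

Set Implicit Arguments.
Unset Strict Implicit.
Unset Printing Implicit Defensive.

Import GRing.Theory.
Local Open Scope ring_scope.

(** * Closure properties of unbundled linear and balanced maps *)

Section Linear.
Variable K : fieldType.

Lemma lin_comp (U V W : lmodType K) (f : V -> W) (g : U -> V) :
  linear f -> linear g -> linear (fun x => f (g x)).
Proof. by move=> fl gl k x y; rewrite gl fl. Qed.

Lemma lin_add (U V : lmodType K) (f g : U -> V) :
  linear f -> linear g -> linear (fun x => f x + g x).
Proof. by move=> fl gl k x y; rewrite fl gl scalerDr addrACA. Qed.

Lemma lin_pair (U V W : lmodType K) (f : U -> V) (g : U -> W) :
  linear f -> linear g -> linear (fun x => (f x, g x) : (V * W)%type).
Proof. by move=> fl gl k x y; rewrite fl gl. Qed.

Lemma fst_linear (U V : lmodType K) : linear (fun p : (U * V)%type => p.1).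
Proof. by []. Qed.

Lemma snd_linear (U V : lmodType K) : linear (fun p : (U * V)%type => p.2).
Proof. by []. Qed.

Lemma linN (U V : lmodType K) (f : U -> V) : linear f -> {morph f : x / - x}.
Proof. by move=> fl x; rewrite -scaleN1r (linZ fl) scaleN1r. Qed.

Lemma linB (U V : lmodType K) (f : U -> V) :
  linear f -> {morph f : x y / x - y}.
Proof. by move=> fl x y; rewrite (linD fl) (linN fl). Qed.

Lemma lin_sum (U V : lmodType K) (f : U -> V) (I : Type) (s : seq I)
    (F : I -> U) : linear f -> f (\sum_(i <- s) F i) = \sum_(i <- s) f (F i).
Proof. by move=> fl; apply: big_morph; [apply: linD | apply: lin0]. Qed.

Lemma balanced_comp (M N : lmodType K) (I : Type) (r : I -> M -> M)
    (l : I -> N -> N) (P Q : lmodType K) (f : P -> Q) (g : M -> N -> P) :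
  linear f -> balanced r l g -> balanced r l (fun m n => f (g m n)).
Proof.
move=> fl [gl gr gB]; split=> [n k x y|m k x y|i m n].
- by rewrite gl fl.
- by rewrite gr fl.
- by rewrite gB.
Qed.
End Linear.

(** * Naturality of the trace *)

Section Traces.
Variables (K : fieldType) (B : algType K).

Record is_bhom (M M' : bimod B) (h : M -> M') : Prop := IsBhom {
  bhom_lin : linear h;
  bhom_l : forall b m, h (b ▷ m) = b ▷ h m;
  bhom_r : forall b m, h (m ◁ b) = h m ◁ b }.

Lemma trcl_linear (M : bimod B) : linear (@trcl K B M).
Proof. exact: qcl_linear. Qed.

Lemma trclC (M : bimod B) b (m : M) : trcl (b ▷ m) = trcl (m ◁ b).
Proof.
by apply/subr0_eq; rewrite -(linB (@trcl_linear M)); apply: qcl_gen; exists b, m.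
Qed.

Lemma tr_liftP (M : bimod B) (W : lmodType K) (f : M -> W) :
  linear f -> (forall b m, f (b ▷ m) = f (m ◁ b)) ->
  linear (qlift f : tr M -> W) /\ forall m, qlift f (trcl m) = f m.
Proof.
move=> fl fC; have f0 g : comm_rel g -> f g = 0.
  by move=> [b [m ->]]; rewrite (linB fl) fC subrr.
by split=> [|m]; [apply: qlift_linear | apply: qliftE].
Qed.

Section ModTensMap.
Variables (N : lmod B) (M M' : bimod B) (h : M -> M').
Hypothesis hP : is_bhom h.

Lemma modtens_mapE (m : M) (n : N) :
  tmap h id (m ⊗ n : modtens M N) = h m ⊗ n :> modtens M' N.
Proof.
by case: hP => hl _ hr; apply: tmapE => // b x y; rewrite hr; apply: tpureB.
Qed.

Lemma modtens_map_linear : linear (tmap h id : modtens M N -> modtens M' N).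
Proof.
by case: hP => hl _ hr; apply: tmap_linear => // b x y; rewrite hr; apply: tpureB.
Qed.
End ModTensMap.

Lemma modtens_actE (N : lmod B) (M : bimod B) b (m : M) (n : N) :
  b • (m ⊗ n : modtens M N) = (b ▷ m) ⊗ n.
Proof.
apply: tmapE => //; first exact: act_linr (bm_lP M) b.
by move=> c x y; rewrite -bm_lr; apply: tpureB.
Qed.

Lemma modtens_map_lhom (N : lmod B) (M M' : bimod B) (h : M -> M') :
  is_bhom h -> is_lhom (tmap h id : modtens M N -> modtens M' N).
Proof.
move=> hP; have L := modtens_map_linear (N := N) hP; split=> // b t.
elim/tens_ind: t => [m n|s t Es Et].
  by rewrite modtens_actE !modtens_mapE // modtens_actE (bhom_l hP).
by rewrite !(linD (act_linr (lm_actP _) b), linD L) Es Et.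
Qed.

Section DualBasis.
Variable n : nat.

Let free_act (b : B) (c : {ffun 'I_n -> B}) : {ffun 'I_n -> B} :=
  [ffun i => b * c i].

Lemma free_actP : is_act free_act.
Proof.
split=> [c k a b|b k c d|c|a b c]; apply/ffunP => i; rewrite !ffunE.
- by rewrite mulrDl scalerAl.
- by rewrite mulrDr scalerAr.
- by rewrite mul1r.
- by rewrite mulrA.
Qed.

Definition free_lmod : lmod B := Lmod free_actP.
End DualBasis.

(** Generators define a surjection from the free module B^n onto N; projectivity splits it, and the
    coordinates of the splitting are the functionals [th i]. *)
Lemma dual_basis (N : lmod B) : fin_gen N -> projective N ->
  exists (n : nat) (g : 'I_n -> N) (th : 'I_n -> dual N),
    forall x, x = \sum_i th i x • g i.
Proof.
move=> [n [g gP]] projN.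
have aP := lm_actP N.
pose p (c : free_lmod n) : N := \sum_i (c : {ffun _ -> _}) i • g i.
have pP : is_lhom p.
  split=> [k c d|b c]; rewrite /p.
    rewrite scaler_sumr -big_split; apply: eq_bigr => i _.
    by rewrite !ffunE (act_linl aP).
  rewrite (lin_sum _ _ (act_linr aP b)); apply: eq_bigr => i _.
  by rewrite !ffunE (act_M aP).
have p_surj q : exists x, p x = q.
  have [c ->] := gP q; exists [ffun i => c i].
  by apply: eq_bigr => i _; rewrite ffunE.
have idP : is_lhom (@id N) by [].
have [h [hl ha] hK] := projN _ _ _ _ pP p_surj idP.
have thP i : (fun x => (h x : {ffun _ -> _}) i) \in @dual_pred K B N.
  by apply/dual_predP; split=> [k x y|b x]; rewrite (hl, ha) !ffunE.
by exists n, g, (fun i => MkDual (thP i)) => x; rewrite -[LHS]hK.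
Qed.

Section Contraction.
Variables (N : lmod B) (M : bimod B).

Lemma dual_linear (th : dual N) : linear (th : N -> B).
Proof. by have /dual_predP[] := dual_valP th. Qed.

Lemma dual_act (th : dual N) b n : th (b • n) = b * th n.
Proof. by have /dual_predP[_ ->] := dual_valP th. Qed.

Lemma dual_eval_linear x : linear (fun th : dual N => th x).
Proof. by []. Qed.

Definition dual_contract (th : dual N) : modtens M N -> tr M :=
  tlift (fun (m : M) (n : N) => trcl (th n ▷ m)).

Lemma dual_contract_balanced (th : dual N) :
  balanced (fun (b : B) (m : M) => m ◁ b) (fun (b : B) (n : N) => b • n)
    (fun (m : M) (n : N) => trcl (th n ▷ m)).
Proof.
split=> [n|m|b m n].
- exact: lin_comp (@trcl_linear M) (act_linr (bm_lP M) (th n)).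
- exact: lin_comp (@trcl_linear M) (lin_comp (act_linl (bm_lP M) m) (dual_linear th)).
- by rewrite dual_act (act_M (bm_lP M)) -bm_lr -trclC.
Qed.

Lemma dual_contractE th m n : dual_contract th (m ⊗ n) = trcl (th n ▷ m).
Proof. exact: tliftE (dual_contract_balanced th) _ _. Qed.

Lemma dual_contract_linear th : linear (dual_contract th).
Proof. exact: tlift_linear (dual_contract_balanced th). Qed.

Lemma contract_balanced :
  balanced (@dual_r K B N) (fun (b : B) (t : modtens M N) => b • t) dual_contract.
Proof.
have L := dual_contract_linear; have al := act_linl (bm_lP M).
split=> [t k th th'|th|b th t]; last 1 first.
- have lr := act_linr (modtens_act M N) b.
  elim/tens_ind: t => [m n|s t Es Et].
    by rewrite modtens_actE !dual_contractE /= (act_M (bm_lP M)).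
  by rewrite [b • _](linD lr) !(linD (L _)) Es Et.
- elim/tens_ind: t => [m n|s t Es Et].
    by rewrite !dual_contractE /= !fctE al trcl_linear.
  by rewrite !(linD (L _)) Es Et scalerDr addrACA.
- exact: L.
Qed.

Lemma contractE th t : contract (th ⊗ t : dual_tens N M) = dual_contract th t.
Proof. exact: tliftE contract_balanced _ _. Qed.

Lemma dual_hom_balanced x :
  balanced (@dual_r K B N) (fun (b : B) (t : modtens M N) => b • t)
    (fun (th : dual N) (t : modtens M N) => th x • t).
Proof.
have aP := lm_actP (modtens M N).
split=> [t k th th'|th|b th t].
- exact: (act_linl aP).
- exact: (act_linr aP).
- exact: (act_M aP).
Qed.

Lemma dual_homE th t x : dual_hom (th ⊗ t : dual_tens N M) x = th x • t.
Proof. exact: tliftE (dual_hom_balanced x) _ _. Qed.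

Lemma dual_hom_linear x : linear (fun u : dual_tens N M => dual_hom u x).
Proof. exact: tlift_linear (dual_hom_balanced x). Qed.

(** B-linearity of [psi] makes Σ th_i ⊗ psi(g_i) a preimage of [psi], so [xget] does not fall back
    on its default 0. Injectivity of the canonical map then makes the choice irrelevant. *)
Lemma Tr_dual_basis n (g : 'I_n -> N) (th : 'I_n -> dual N)
    (thP : forall x, x = \sum_i th i x • g i) (psi : N -> modtens M N) :
  is_lhom psi -> Tr psi = \sum_i dual_contract (th i) (psi (g i)).
Proof.
move=> [psil psia]; have cl := tlift_linear contract_balanced.
have dl := @dual_hom_linear.
rewrite /Tr; set P := (X in xget 0 X).
have ex : P (\sum_i (th i ⊗ psi (g i) : dual_tens N M)).
  move=> x; rewrite (lin_sum _ _ (dl x)) [x in RHS]thP (lin_sum _ _ psil).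
  by apply: eq_bigr => i _; rewrite dual_homE psia.
(* Every [u] is recovered from the homomorphism it induces; this is the injectivity. *)
have expand u : u = \sum_i (th i ⊗ dual_hom u (g i) : dual_tens N M).
  elim/tens_ind: u => [eta t|s t Es Et]; last first.
    rewrite [LHS](f_equal2 +%R Es Et) -big_split; apply: eq_bigr => i _.
    by rewrite (linD (dl _)) (linD (tpure_linr _ _ _)).
  (* The dual form of [thP]: a functional eta equals Σ th_i · eta(g_i), and the scalars eta(g_i)
     then cross the tensor sign. *)
  transitivity (\sum_i ((dual_r (eta (g i)) (th i)) ⊗ t : dual_tens N M)).
    rewrite -(lin_sum _ _ (tpure_linl _ _ t)); congr (_ ⊗ _).
    apply: val_inj => /=; apply/funext => x; rewrite {1}[x]thP.
    rewrite (lin_sum _ _ (dual_linear _)) [RHS](lin_sum _ _ (dual_eval_linear x)).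
    by apply: eq_bigr => i _; rewrite dual_act.
  by apply: eq_bigr => i _; rewrite dual_homE; apply: tpureB.
have uP := xgetPex 0 (ex_intro _ _ ex).
set u := xget 0 P in uP *; rewrite [u]expand [LHS](lin_sum _ _ cl).
by apply: eq_bigr => i _; rewrite [LHS]contractE uP.
Qed.
End Contraction.

Definition trmap_bhom (M M' : bimod B) (h : M -> M') : tr M -> tr M' :=
  qlift (fun m => trcl (h m)).

Lemma trmap_bhomP (M M' : bimod B) (h : M -> M') : is_bhom h ->
  linear (trmap_bhom h) /\ forall m, trmap_bhom h (trcl m) = trcl (h m).
Proof.
move=> [hl ha hr]; apply: tr_liftP => [|b m].
  exact: lin_comp (@trcl_linear M') hl.
by rewrite ha hr trclC.
Qed.

(** One dual basis serves both traces, which reduces the claim to h(θ(n) m) = θ(n) h(m). *)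
Lemma Tr_natural (N : lmod B) (M M' : bimod B) (h : M -> M')
    (psi : N -> modtens M N) :
  fin_gen N -> projective N -> is_bhom h -> is_lhom psi ->
  Tr (fun x => tmap h id (psi x) : modtens M' N) = trmap_bhom h (Tr psi).
Proof.
move=> fgN projN hP psiP; have [n [g [th thP]]] := dual_basis fgN projN.
have [tl tE] := trmap_bhomP hP; have [hl ha] := modtens_map_lhom N hP.
rewrite (Tr_dual_basis thP psiP) (Tr_dual_basis thP); last first.
  case: psiP => psil psia; split=> [|b x]; first exact: lin_comp hl psil.
  by rewrite psia ha.
rewrite (lin_sum _ _ tl); apply: eq_bigr => i _.
have L := dual_contract_linear; elim/tens_ind: (psi _) => [m x|s t Es Et].
  by rewrite modtens_mapE // !dual_contractE tE (bhom_l hP).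
by rewrite (linD hl) !(linD (L _ _ _)) Es Et (linD tl).
Qed.
End Traces.

(** * Differentials and connections *)

Section Differentials.
Variables (K : fieldType) (B : algType K) (R : {pred B}).

Lemma der_comp (M M' : bimod B) (h : M -> M') (D : B -> M) :
  is_bhom h -> is_der R D -> is_der R (fun b => h (D b)).
Proof.
move=> [hl ha hr] [Dl DM DR]; split=> [|a b|s Rs].
- exact: lin_comp hl Dl.
- by rewrite DM (linD hl) ha hr.
- by rewrite DR // (lin0 hl).
Qed.

Lemma dOm_der : is_der R (dOm R : B -> Omegabm R).
Proof.
split=> [k a b|a b|s Rs]; apply: val_inj => /=.
- rewrite tpure_linl tpure_linr scalerBr opprD -!addrA; congr (_ + _).
  by rewrite addrCA.
- rewrite (linB (act_linr (outer_rP R) b)) (linB (act_linr (outer_lP R) a)).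
  by rewrite !outer_rE !outer_lE mul1r mulr1 addrA subrK.
- have := @tpureB _ _ _ _ (fun (s : {s : B | s \in R}) (x : B) => x * val s)
    (fun (s : {s : B | s \in R}) (x : B) => val s * x) (exist _ s Rs) 1 1.
  by rewrite /= mul1r mulr1 => ->; rewrite subrr.
Qed.

Section Contraction.
Variables (M : bimod B) (D : B -> M).
Hypothesis DP : is_der R D.

Let i_tens : tens_sub R -> M := tlift (fun x y => x ▷ D y).

Let i_tensE x y : i_tens (x ⊗ y) = x ▷ D y.
Proof. exact: tliftE (iOm_balanced DP) _ _. Qed.

Let i_tens_linear : linear i_tens.
Proof. exact: tlift_linear (iOm_balanced DP). Qed.

Let i_tens_l b (t : tens_sub R) :
  i_tens (tmap ( *%R b) id t : tens_sub R) = b ▷ i_tens t.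
Proof.
elim/tens_ind: t => [x y|s t Es Et].
  by rewrite outer_lE !i_tensE (act_M (bm_lP M)).
rewrite (linD (act_linr (outer_lP R) b)) !(linD i_tens_linear) Es Et.
by rewrite (linD (act_linr (bm_lP M) b)).
Qed.

(** On B ⊗_R B the map x ⊗ y ↦ x D(y) is left linear, but D(yb) contributes y D(b) on the right.
    These contributions add up to mult(t) D(b), which is zero on Ω^1. *)
Let i_tens_r b (t : tens_sub R) :
  i_tens (tmap id (fun x : B => x * b) t : tens_sub R) =
  i_tens t ◁ b + tmult t ▷ D b.
Proof.
have lr := act_linr (bm_lP M).
elim/tens_ind: t => [x y|s t Es Et].
  rewrite outer_rE !i_tensE tmultE (der_mul DP) (linD (lr x)) bm_lr.
  by rewrite (act_M (bm_lP M)).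
rewrite (linD (act_linr (outer_rP R) b)) !(linD i_tens_linear) Es Et.
rewrite (linD (@tmult_linear _ _ R)) (linD (act_linl (bm_lP M) (D b))).
by rewrite (linD (act_linr (bm_rP M) b)) addrACA.
Qed.

Lemma der1 : D 1 = 0.
Proof.
apply: (addrI (D 1)); rewrite addr0 -[in RHS](mulr1 1) (der_mul DP).
by rewrite (act_1 (bm_lP M)) [D 1 ◁ 1](act_1 (bm_rP M)).
Qed.

Lemma iOm_bhom : is_bhom (iOm D : Omegabm R -> M).
Proof.
split=> [k v w|b w|b w]; first exact: i_tens_linear.
- exact: i_tens_l.
- by rewrite [LHS]i_tens_r (eqP (Omega_valP w)) (lin0 (act_linl (bm_lP M) _)) addr0.
Qed.

Lemma iOm_d b : iOm D (dOm R b) = D b.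
Proof.
rewrite [LHS](linB i_tens_linear) !i_tensE der1.
by rewrite (lin0 (act_linr (bm_lP M) b)) subr0 (act_1 (bm_lP M)).
Qed.
End Contraction.

Lemma iOm_comp (M M' : bimod B) (h : M -> M') (D : B -> M) (w : Omega R) :
  is_bhom h -> is_der R D -> iOm (fun b => h (D b)) w = h (iOm D w) :> M'.
Proof.
move=> hP DP; have DP' := der_comp hP DP; case: (hP) => hl ha _.
apply: (tens_ext (tlift_linear (iOm_balanced DP'))
  (lin_comp hl (tlift_linear (iOm_balanced DP)))) => x y.
by rewrite (tliftE (iOm_balanced DP')) (tliftE (iOm_balanced DP)) ha.
Qed.

(** Since x dy = x ⊗ y - xy ⊗ 1, this is the retraction t ↦ t - mult(t) ⊗ 1 of B ⊗_R B onto Ω^1. It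
    lets identities about elements of Ω^1 be stated for, and checked on, arbitrary pure tensors. *)
Definition Omega_proj : tens_sub R -> Omegabm R :=
  tlift (fun x y => x ▷ (dOm R y : Omegabm R)).

Lemma Omega_projE x y : Omega_proj (x ⊗ y) = x ▷ (dOm R y : Omegabm R).
Proof. exact: tliftE (iOm_balanced dOm_der) _ _. Qed.

Lemma Omega_proj_linear : linear Omega_proj.
Proof. exact: tlift_linear (iOm_balanced dOm_der). Qed.

Lemma Omega_projK (w : Omegabm R) : Omega_proj (Omega_val w) = w.
Proof.
apply: val_inj; rewrite /=.
have vl : linear (@Omega_val K B R) by [].
have key : forall t, Omega_val (Omega_proj t) = t - tmult t ⊗ 1.
  elim/tens_ind => [x y|s t Es Et].
    rewrite Omega_projE /= (linB (act_linr (outer_lP R) x)) !outer_lE mulr1.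
    by rewrite tmultE.
  rewrite (linD Omega_proj_linear) (linD vl) Es Et (linD (@tmult_linear _ _ R)).
  by rewrite (linD (tpure_linl _ _ _)) opprD addrACA.
by rewrite key (eqP (Omega_valP w)) (lin0 (tpure_linl _ _ _)) subr0.
Qed.

Section Connection.
Variables (N : lmod B) (nabla : N -> modtens (Omegabm R) N).
Hypothesis nablaP : is_connection nabla.
Variables (M : bimod B) (D : B -> M).
Hypothesis DP : is_der R D.

Lemma connection_push_linear :
  linear (fun n => tmap (iOm D) id (nabla n) : modtens M N).
Proof.
case: nablaP => nl _.
exact: lin_comp (modtens_map_linear (N := N) (iOm_bhom DP)) nl.
Qed.

(** The map i_D sends db to D(b), so it turns the Leibniz rule of the connection into one governed
    by D. *)
Lemma connection_push b n :
  tmap (iOm D) id (nabla (b • n)) =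
  D b ⊗ n + b • (tmap (iOm D) id (nabla n) : modtens M N) :> modtens M N.
Proof.
case: nablaP => nl nM; have iP := iOm_bhom DP.
rewrite nM (linD (modtens_map_linear (N := N) iP)) (modtens_mapE iP) iOm_d //.
by rewrite (lhom_act (modtens_map_lhom N iP)).
Qed.
End Connection.
End Differentials.

(** * Functoriality of tensor products, multiplication maps, and linearity over A^e *)

Section TensorLemmas.
Variable K : fieldType.

Lemma tmapv_comp (U V U' V' U'' V'' : lmodType K) (f : U' -> U'') (g : V' -> V'')
    (f' : U -> U') (g' : V -> V') (t : U ⊗ V) :
  linear f -> linear g -> linear f' -> linear g' ->
  tmap f g (tmap f' g' t : U' ⊗ V') =
  tmap (fun x => f (f' x)) (fun x => g (g' x)) t :> U'' ⊗ V''.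
Proof.
move=> fl gl fl' gl'; have l1 := tmapv_linear fl gl; have l2 := tmapv_linear fl' gl'.
have l3 := tmapv_linear (lin_comp fl fl') (lin_comp gl gl').
apply: (tens_ext (lin_comp l1 l2) l3) => x y.
by rewrite tmapvE // tmapvE // tmapvE //; apply: lin_comp.
Qed.

Lemma tmapv_id (U V : lmodType K) (t : U ⊗ V) : tmap id id t = t :> U ⊗ V.
Proof.
by apply: (tens_ext (tmapv_linear _ _)) t => // x y; rewrite tmapvE.
Qed.

Lemma tmapv_linl (U M N M' N' : lmodType K) (f : U -> M -> M') (g : N -> N')
    (t : M ⊗ N) :
  (forall x, linear (f x)) -> (forall m, linear (f^~ m)) -> linear g ->
  linear (fun x => tmap (f x) g t : M' ⊗ N').
Proof.
move=> fr fl gl k x y; elim/tens_ind: t => [m n|s t Es Et].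
  by rewrite !tmapvE // fl tpure_linl.
have L z := tmapv_linear (fr z) gl.
by rewrite !(linD (L _)) Es Et scalerDr addrACA.
Qed.

Lemma tmapv_linr (U M N M' N' : lmodType K) (f : M -> M') (g : U -> N -> N')
    (t : M ⊗ N) :
  linear f -> (forall x, linear (g x)) -> (forall n, linear (g^~ n)) ->
  linear (fun x => tmap f (g x) t : M' ⊗ N').
Proof.
move=> fl gr gl k x y; elim/tens_ind: t => [m n|s t Es Et].
  by rewrite !tmapvE // gl tpure_linr.
have L z := tmapv_linear fl (gr z).
by rewrite !(linD (L _)) Es Et scalerDr addrACA.
Qed.

Lemma tswap_tmap (U V W X : lmodType K) (f : U -> V) (g : W -> X) (t : U ⊗ W) :
  linear f -> linear g -> tswap (tmap f g t : V ⊗ X) = tmap g f (tswap t).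
Proof.
move=> fl gl; have sl := @tswap_linear K.
apply: (tens_ext (lin_comp (sl _ _) (tmapv_linear fl gl))
  (lin_comp (tmapv_linear gl fl) (sl _ _))) => x y.
by rewrite tmapvE // !tswapE tmapvE.
Qed.

Lemma tswapK (U V : lmodType K) (t : U ⊗ V) : tswap (tswap t) = t.
Proof.
apply: (tens_ext (lin_comp (@tswap_linear K _ _) (@tswap_linear K _ _))
  (@id_linear _ _)) => x y.
by rewrite !tswapE.
Qed.

Lemma sym_linear (V : lmodType K) : linear (@sym K V).
Proof. exact: lin_add (@id_linear _ _) (@tswap_linear _ _ _). Qed.

Lemma sym_tswap (V : lmodType K) (t : V ⊗ V) : sym (tswap t) = sym t.
Proof. by rewrite /sym tswapK addrC. Qed.

Variable A : algType K.

Lemma mulr_linl (b : A) : linear (fun x : A => x * b).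
Proof. exact: act_linr (mulr_act A) b. Qed.

Lemma mulr_linr (b : A) : linear (fun x : A => b * x).
Proof. exact: act_linr (mull_act A) b. Qed.

Lemma multA_balanced : balanced (void_act A) (void_act A) (fun a b : A => a * b).
Proof. by apply: void_balanced => x; [apply: mulr_linl | apply: mulr_linr]. Qed.

Lemma multAE (a b : A) : multA (a ⊗ b) = a * b.
Proof. exact: tliftE multA_balanced _ _. Qed.

Lemma multA_linear : linear (@multA K A).
Proof. exact: tlift_linear multA_balanced. Qed.

Lemma multA_l (a : A) (t : A ⊗ A) : multA (tmap (fun x => a * x) id t) = a * multA t.
Proof.
apply: (tens_ext (lin_comp multA_linear (tmapv_linear (mulr_linr a) (@id_linear _ _)))
  (lin_comp (mulr_linr a) multA_linear)) t => x y.
by rewrite tmapvE ?multAE ?mulrA //; apply: mulr_linr.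
Qed.

Lemma multA_r (a : A) (t : A ⊗ A) : multA (tmap id (fun x => x * a) t) = multA t * a.
Proof.
apply: (tens_ext (lin_comp multA_linear (tmapv_linear (@id_linear _ _) (mulr_linl a)))
  (lin_comp (mulr_linl a) multA_linear)) t => x y.
by rewrite tmapvE ?multAE ?mulrA //; apply: mulr_linl.
Qed.

Lemma bimod_envE (M : bimod A) (a : A) (b : A^c) (m : M) :
  (a ⊗ b : env A) • (m : bimod_env M) = a ▷ (m ◁ (b : A)).
Proof.
exact: (env_actE (act_linl (bm_lP M)) (act_linr (bm_lP M)) (act_linl (bm_rP M))).
Qed.
(** The elements a ⊗ 1 and 1 ⊗ b generate A^e as an algebra, so left and right multiplications can
    be treated separately. *)
Lemma env_lhom (N P : lmod (env A)) (f : N -> P) : linear f ->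
  (forall (a : A) n, f ((a ⊗ (1 : A^c) : env A) • n) = (a ⊗ (1 : A^c) : env A) • f n) ->
  (forall (b : A^c) n, f (((1 : A) ⊗ b : env A) • n) = ((1 : A) ⊗ b : env A) • f n) ->
  is_lhom f.
Proof.
move=> fl fa fb; have lP := lm_actP P; have lN := lm_actP N.
split=> // s n; elim/tens_ind: s => [a b|s t Es Et]; last first.
  by rewrite (linD (act_linl lN n)) (linD fl) Es Et (linD (act_linl lP _)).
have -> : a ⊗ b = (a ⊗ (1 : A^c) : env A) * ((1 : A) ⊗ b : env A) :> env A.
  by rewrite envM mulr1 mul1r.
by rewrite (act_M lN) fa fb (act_M lP).
Qed.
End TensorLemmas.

(** * The bimodule trip(A) *)

Section Trip.
Variables (K : fieldType) (A : algType K).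

Implicit Types (a x : A) (b z : A^c) (t : A ⊗ A) (u : A^c ⊗ A^c).

(** The argument [t] stays an arbitrary element of A ⊗ A, because it will be a value Θ(a), which
    need not be a pure tensor; likewise [u] in [tpairr]. *)
Definition tpairl t z : trip A := (t ⊗ z, 0).
Definition tpairr x u : trip A := (0, x ⊗ u).

Lemma tpair_ind (Q : trip A -> Prop) :
  (forall t z, Q (tpairl t z)) -> (forall x u, Q (tpairr x u)) ->
  (forall p q, Q p -> Q q -> Q (p + q)) -> forall p, Q p.
Proof.
move=> Ql Qr QD [p q].
have -> : (p, q) = ((p, 0) : trip A) + ((0, q) : trip A) :> trip A.
  by congr (_, _); rewrite ?addr0 ?add0r.
apply: (QD).
- apply: (@tens_ind _ _ _ _ _ _ (fun p => Q (p, 0))) p => // s t Qs Qt.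
  by rewrite -[0](addr0 0); exact: (QD (_, _) (_, _)).
- apply: (@tens_ind _ _ _ _ _ _ (fun q => Q (0, q))) q => // s t Qs Qt.
  by rewrite -[0](addr0 0); exact: (QD (_, _) (_, _)).
Qed.

Lemma tpairl_linl z : linear (tpairl^~ z).
Proof.
move=> k s t; rewrite /tpairl (tpure_linl _ _ z).
by congr (_, _); rewrite /= scaler0 addr0.
Qed.

Lemma tpairl_linr t : linear (tpairl t).
Proof.
move=> k y z; rewrite /tpairl (tpure_linr _ _ t).
by congr (_, _); rewrite /= scaler0 addr0.
Qed.

Lemma tpairr_linl u : linear (tpairr^~ u).
Proof.
move=> k x y; rewrite /tpairr (tpure_linl _ _ u).
by congr (_, _); rewrite /= scaler0 addr0.
Qed.

Lemma tpairr_linr x : linear (tpairr x).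
Proof.
move=> k u v; rewrite /tpairr (tpure_linr _ _ x).
by congr (_, _); rewrite /= scaler0 addr0.
Qed.

Let lE a b := env_actE (act_linl (trip_laP A)) (act_linr (trip_laP A))
  (act_linl (trip_lbP A)) a b.
Let rE a b := env_actE (act_linl (trip_raP A)) (act_linr (trip_raP A))
  (act_linl (trip_rbP A)) a b.

Lemma trip_l a b t z x u :
  (a ⊗ b : env A) ▷ (tpairl t z + tpairr x u) =
  tpairl (tmap (fun x => a * x) id t) (b * z) +
  tpairr (a * x) (tmap (fun y : A^c => b * y) id u).
Proof.
rewrite [LHS]lE /trip_la /trip_lb /map3l /map3r /=.
have al := @mulr_linr K A a; have bl := @mulr_linr K A^c b.
have al' : linear (tmap (fun x => a * x) id : A ⊗ A -> A ⊗ A) by apply: tmapv_linear.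
have bl' : linear (tmap (fun x : A^c => b * x) id : A^c ⊗ A^c -> A^c ⊗ A^c).
  by apply: tmapv_linear.
have il : linear (tmap id id : A ⊗ A -> A ⊗ A) by apply: tmapv_linear.
have il' : linear (tmap id id : A^c ⊗ A^c -> A^c ⊗ A^c) by apply: tmapv_linear.
rewrite addr0 add0r !tmapvE // !tmapv_id.
by congr (_, _); rewrite ?addr0 ?add0r.
Qed.

Lemma trip_r a b t z x u :
  (tpairl t z + tpairr x u) ◁ (a ⊗ b : env A) =
  tpairl (tmap id (fun y => y * a) t) (z * b) +
  tpairr (x * a) (tmap id (fun y : A^c => y * b) u).
Proof.
rewrite [LHS]rE /trip_ra /trip_rb /map3l /map3r /=.
have al := @mulr_linl K A a; have bl := @mulr_linl K A^c b.
have al' : linear (tmap id (fun x => x * a) : A ⊗ A -> A ⊗ A) by apply: tmapv_linear.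
have bl' : linear (tmap id (fun x : A^c => x * b) : A^c ⊗ A^c -> A^c ⊗ A^c).
  by apply: tmapv_linear.
have il : linear (tmap id id : A ⊗ A -> A ⊗ A) by apply: tmapv_linear.
have il' : linear (tmap id id : A^c ⊗ A^c -> A^c ⊗ A^c) by apply: tmapv_linear.
rewrite addr0 add0r !tmapvE // !tmapv_id.
by congr (_, _); rewrite ?addr0 ?add0r.
Qed.

Lemma tpairl_l a b t z :
  (a ⊗ b : env A) ▷ tpairl t z = tpairl (tmap (fun x => a * x) id t) (b * z).
Proof.
have := trip_l a b t z 0 0.
by rewrite mulr0 !(lin0 (tpairr_linl _)) !addr0.
Qed.

Lemma tpairr_l a b x u :
  (a ⊗ b : env A) ▷ tpairr x u = tpairr (a * x) (tmap (fun y : A^c => b * y) id u).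
Proof.
have := trip_l a b 0 0 x u.
by rewrite mulr0 !(lin0 (tpairl_linr _)) !add0r.
Qed.

Lemma tpairl_r a b t z :
  tpairl t z ◁ (a ⊗ b : env A) = tpairl (tmap id (fun y => y * a) t) (z * b).
Proof.
have := trip_r a b t z 0 0.
by rewrite mul0r !(lin0 (tpairr_linl _)) !addr0.
Qed.

Lemma tpairr_r a b x u :
  tpairr x u ◁ (a ⊗ b : env A) = tpairr (x * a) (tmap id (fun y : A^c => y * b) u).
Proof.
have := trip_r a b 0 0 x u.
by rewrite mul0r !(lin0 (tpairl_linr _)) !add0r.
Qed.

Definition trip_mult (p : trip A) : reg (env A) :=
  (tmap (@multA K A) id p.1 : env A) + (tmap id (@multA K A^c) p.2 : env A).

Let mult_l_linear : linear (tmap (@multA K A) id : (A ⊗ A) ⊗ A^c -> env A).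
Proof. exact: tmapv_linear (@multA_linear K A) (@id_linear K A^c). Qed.

Let mult_r_linear : linear (tmap id (@multA K A^c) : A ⊗ (A^c ⊗ A^c) -> env A).
Proof. exact: tmapv_linear (@id_linear K A) (@multA_linear K A^c). Qed.

Lemma trip_mult_linear : linear trip_mult.
Proof.
have fl : linear (fun p : trip_sort A => p.1) := @fst_linear K _ _.
have sl : linear (fun p : trip_sort A => p.2) := @snd_linear K _ _.
exact: lin_add (lin_comp mult_l_linear fl) (lin_comp mult_r_linear sl).
Qed.

Lemma trip_multl t z : trip_mult (tpairl t z) = (multA t) ⊗ z.
Proof.
transitivity (tmap (@multA K A) id (t ⊗ z : (A ⊗ A) ⊗ A^c) + 0 : env A).
  by congr (_ + _); apply: lin0 mult_r_linear.
rewrite addr0; exact: tmapvE (@multA_linear K A) (@id_linear K A^c).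
Qed.

Lemma trip_multr x u : trip_mult (tpairr x u) = x ⊗ (multA u : A^c).
Proof.
transitivity (0 + tmap id (@multA K A^c) (x ⊗ u : A ⊗ (A^c ⊗ A^c)) : env A).
  by congr (_ + _); apply: lin0 mult_l_linear.
rewrite add0r; exact: tmapvE (@id_linear K A) (@multA_linear K A^c).
Qed.

(** On the two factors that are merged, the left action multiplies the first from the left and the
    right action multiplies the second from the right. Both operations survive multiplying the
    factors together; in the second summand this product is the one of A^op. *)
Lemma trip_mult_bhom : is_bhom trip_mult.
Proof.
have ml := trip_mult_linear.
split=> // s p; elim/tens_ind: s => [a b|s s' E E'].
- elim/tpair_ind: p => [t z|x u|p q E E'].
  + by rewrite tpairl_l !trip_multl multA_l [RHS]envM.
  + by rewrite tpairr_l !trip_multr multA_l [RHS]envM.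
  + by rewrite (linD (act_linr (bm_lP (trip A)) _)) !(linD ml) E E' [RHS]mulrDr.
- by rewrite (linD (act_linl (bm_lP (trip A)) _)) (linD ml) E E' [RHS]mulrDl.
- elim/tpair_ind: p => [t z|x u|p q E E'].
  + by rewrite tpairl_r !trip_multl multA_r [RHS]envM.
  + by rewrite tpairr_r !trip_multr multA_r [RHS]envM.
  + by rewrite (linD (act_linr (bm_rP (trip A)) _)) !(linD ml) E E' [RHS]mulrDl.
- by rewrite (linD (act_linl (bm_rP (trip A)) _)) (linD ml) E E' [RHS]mulrDr.
Qed.
End Trip.

(** * Extension of double derivations from A to A^e *)

Section DoubleDerivation.
Variables (K : fieldType) (A : algType K).

(** The flip underlying Θ^op, separated from Θ so that its linearity and its exchange of left and
    right multiplications can be stated: [dder_op Th a] is [optens (Th a)] by definition. *)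
Definition optens (t : A ⊗ A) : A^c ⊗ A^c :=
  tlift (fun x y : A => (y : A^c) ⊗ (x : A^c) : A^c ⊗ A^c) t.

Let optens_balanced :
  balanced (void_act A) (void_act A)
    (fun x y : A => (y : A^c) ⊗ (x : A^c) : A^c ⊗ A^c).
Proof. exact: (tswap_balanced A A). Qed.

Lemma optensE (x y : A) : optens (x ⊗ y) = (y : A^c) ⊗ (x : A^c).
Proof. exact: tliftE optens_balanced _ _. Qed.

Lemma optens_linear : linear optens.
Proof. exact: tlift_linear optens_balanced. Qed.

Lemma optens_l (c : A) (t : A ⊗ A) :
  optens (tmap (fun x => c * x) id t) = tmap id (fun y : A^c => y * (c : A^c)) (optens t).
Proof.
have cl : linear (fun y : A^c => y * (c : A^c)) := mulr_linl (c : A^c).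
apply: (tens_ext (lin_comp optens_linear (tmapv_linear (mulr_linr c) (@id_linear _ _)))
  (lin_comp (tmapv_linear (@id_linear _ _) cl) optens_linear)) t => x y.
by rewrite tmapvE // ?optensE ?tmapvE //; apply: mulr_linr.
Qed.

Lemma optens_r (c : A) (t : A ⊗ A) :
  optens (tmap id (fun x => x * c) t) = tmap (fun y : A^c => (c : A^c) * y) id (optens t).
Proof.
have cl : linear (fun y : A^c => (c : A^c) * y) := mulr_linr (c : A^c).
apply: (tens_ext (lin_comp optens_linear (tmapv_linear (@id_linear _ _) (mulr_linl c)))
  (lin_comp (tmapv_linear cl (@id_linear _ _)) optens_linear)) t => x y.
by rewrite tmapvE // ?optensE ?tmapvE //; apply: mulr_linl.
Qed.

(** The flip of the factors and the reversed product of A^op cancel. *)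
Lemma multA_op (t : A ⊗ A) : multA (optens t) = multA t.
Proof.
have ml : linear (@multA K A^c : A^c ⊗ A^c -> A^c) := @multA_linear K A^c.
apply: (tens_ext (lin_comp ml optens_linear) (@multA_linear K A)) t => x y.
by rewrite optensE !multAE.
Qed.

Variables (S : {pred A}) (Th : A -> A ⊗ A).
Hypothesis ThP : is_der S (Th : A -> outer A).

Let Th_lin : linear Th := der_lin ThP.

Let dder_env_balanced : balanced (void_act A) (void_act A^c)
  (fun (a : A) (b : A^c) => (Th a ⊗ b, a ⊗ dder_op Th b) : trip A).
Proof.
apply: void_balanced => [b|a] k x y; congr (_, _).
- by rewrite /= Th_lin tpure_linl.
- by rewrite /= tpure_linl.
- by rewrite /= tpure_linr.
- by rewrite /= -tpure_linr -[dder_op Th _]/(optens _) Th_lin optens_linear.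
Qed.

Lemma dder_envE (a : A) (b : A^c) :
  dder_env Th (a ⊗ b) = tpairl (Th a) b + tpairr a (optens (Th b)).
Proof.
rewrite /dder_env (tliftE dder_env_balanced) /tpairl /tpairr.
by congr (_, _); rewrite ?addr0 ?add0r.
Qed.

Lemma dder_env_linear : linear (dder_env Th).
Proof. exact: tlift_linear dder_env_balanced. Qed.

Lemma dder_env_der : is_der (env_sub S) (dder_env Th : env A -> trip A).
Proof.
have Dl := dder_env_linear; split=> // [s t|s /spanP].
- have L := act_linl (bm_lP (trip A)); have Lr := act_linr (bm_lP (trip A)).
  have R := act_linl (bm_rP (trip A)); have Rr := act_linr (bm_rP (trip A)).
  elim/tens_ind: s => [a b|s s' E E']; last first.
    by rewrite mulrDl !(linD Dl) E E' (linD (L _)) (linD (Rr _)) addrACA.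
  elim/tens_ind: t => [c d|t t' E E']; last first.
    by rewrite mulrDr !(linD Dl) E E' (linD (Lr _)) (linD (R _)) addrACA.
  rewrite envM !dder_envE trip_l trip_r addrACA -(linD (tpairl_linl _)).
  rewrite -(linD (tpairr_linr _)) -optens_l -optens_r -(linD optens_linear).
  (* The product b d in A^op is d b in A, so the two Leibniz terms of Θ^op appear in the opposite
     order. *)
  by rewrite !(der_mul ThP) [in tpairr _ _]addrC.
- elim=> [|k _ x [a [b [Sa Sb ->]]] _ IH]; first exact: lin0 Dl.
  rewrite Dl IH dder_envE (der_sub ThP Sa) (der_sub ThP Sb) (lin0 optens_linear).
  by rewrite (lin0 (tpairl_linl _)) (lin0 (tpairr_linr _)) !addr0 scaler0.
Qed.

Lemma der_env_mult :
  der_env (fun x => multA (Th x)) = (fun s => trip_mult (dder_env Th s)).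
Proof.
apply/funext.
have bal : balanced (void_act A) (void_act A^c) (fun (a : A) (b : A^c) =>
    (multA (Th a) : A) ⊗ b + a ⊗ (multA (Th b) : A^c) : env A).
  have ml : linear (fun x => multA (Th x)) := lin_comp (@multA_linear K A) Th_lin.
  apply: void_balanced => [b|a].
    exact: lin_add (lin_comp (tpure_linl _ _ b) ml) (tpure_linl _ _ _).
  exact: lin_add (tpure_linr _ _ _) (lin_comp (tpure_linr _ _ a) ml).
apply: (tens_ext (tlift_linear bal)
  (lin_comp (@trip_mult_linear K A) dder_env_linear)) => a b.
rewrite (tliftE bal) dder_envE (linD (@trip_mult_linear K A)) trip_multl trip_multr.
by rewrite multA_op.
Qed.
End DoubleDerivation.

(** * Computing in trip(A) ⊗ M through (A ⊗ M) ⊕ (M ⊗ A) *)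

Section TripInverse.
Variables (K : fieldType) (A : algType K) (M : bimod A).

Let TM := modtens (trip A) (bimod_env M).

Definition trip_invl (s : A ⊗ M) : TM := tlift (fun (x : A) (m : M) =>
  (((x ⊗ (1 : A) : A ⊗ A) ⊗ (1 : A^c), 0) : trip A) ⊗ (m : bimod_env M) : TM) s.

Definition trip_invr (s : M ⊗ A) : TM := tlift (fun (m : M) (y : A) =>
  ((0, (1 : A) ⊗ ((y : A^c) ⊗ (1 : A^c) : A^c ⊗ A^c)) : trip A) ⊗ (m : bimod_env M)
    : TM) s.

Lemma trip_invE q : trip_inv q = trip_invl q.1 + trip_invr q.2.
Proof. by []. Qed.

Let invl_balanced : balanced (void_act A) (void_act M) (fun (x : A) (m : M) =>
  (tpairl (x ⊗ 1) 1) ⊗ (m : bimod_env M) : TM).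
Proof.
apply: void_balanced => [m|x]; last exact: tpure_linr.
apply: lin_comp (tpure_linl _ _ m) _.
exact: lin_comp (tpairl_linl 1) (tpure_linl _ _ 1).
Qed.

Let invr_balanced : balanced (void_act M) (void_act A) (fun (m : M) (y : A) =>
  (tpairr 1 ((y : A^c) ⊗ (1 : A^c))) ⊗ (m : bimod_env M) : TM).
Proof.
apply: void_balanced => [y|m]; first exact: tpure_linr.
apply: lin_comp (tpure_linl _ _ m) _.
exact: lin_comp (tpairr_linr (1 : A)) (tpure_linl _ _ (1 : A^c)).
Qed.

Lemma trip_invlE (x : A) (m : M) :
  trip_invl (x ⊗ m) = tpairl (x ⊗ 1) 1 ⊗ (m : bimod_env M).
Proof. exact: tliftE invl_balanced _ _. Qed.

Lemma trip_invrE (m : M) (y : A) :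
  trip_invr (m ⊗ y) = tpairr 1 ((y : A^c) ⊗ (1 : A^c)) ⊗ (m : bimod_env M).
Proof. exact: tliftE invr_balanced _ _. Qed.

Lemma trip_invl_linear : linear trip_invl.
Proof. exact: tlift_linear invl_balanced. Qed.

Lemma trip_invr_linear : linear trip_invr.
Proof. exact: tlift_linear invr_balanced. Qed.

Lemma trip_inv_linear : linear (@trip_inv K A M).
Proof.
exact: lin_add (lin_comp trip_invl_linear (@fst_linear K _ _))
  (lin_comp trip_invr_linear (@snd_linear K _ _)).
Qed.

Let tactE (s : env A) (p : trip A) (m : bimod_env M) :
  p ⊗ (s • m) = (p ◁ s) ⊗ m :> TM.
Proof. by rewrite -tpureB. Qed.

Let act_l (a : A) (m : M) : (a ▷ m : M) = (a ⊗ (1 : A^c) : env A) • (m : bimod_env M).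
Proof. by rewrite bimod_envE [m ◁ _](act_1 (bm_rP M)). Qed.

Let act_r (b : A) (m : M) : (m ◁ b : M) = (1 ⊗ (b : A^c) : env A) • (m : bimod_env M).
Proof. by rewrite bimod_envE (act_1 (bm_lP M)). Qed.

(** Here z ▷ m is (z ⊗ 1) • m, and balancing over A^e moves z into the middle factor of trip(A).
    This identifies the term Θ'(x) ⊗ Θ''(x) dy of L_Θ with Θ^e(x ⊗ 1) ⊗ dy. *)
Lemma trip_invl_left (t : A ⊗ A) (m : M) :
  trip_invl (tmap id (fun z => z ▷ m) t) = tpairl t 1 ⊗ (m : bimod_env M).
Proof.
have ml := act_linl (bm_lP M) m.
apply: (tens_ext (lin_comp trip_invl_linear (tmapv_linear (@id_linear _ _) ml))
  (lin_comp (tpure_linl _ _ m) (tpairl_linl 1))) t => x y.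
rewrite tmapvE // trip_invlE act_l tactE tpairl_r mulr1.
by rewrite tmapvE ?mul1r //; apply: mulr_linl.
Qed.

(** The element b lands in the last factor of trip(A), where left and right multiplication of 1
    agree; it can therefore be passed on to M as a right multiplication. *)
Lemma trip_invl_act (a : A) (b : A^c) (s : A ⊗ M) :
  (a ⊗ b : env A) • trip_invl s =
  trip_invl (tmap (fun x => a * x) (fun m => m ◁ (b : A)) s).
Proof.
have al := mulr_linr a; have bl : linear (fun m : M => m ◁ b) := act_linr (bm_rP M) b.
have Al := act_linr (lm_actP TM) (a ⊗ b).
apply: (tens_ext (lin_comp Al trip_invl_linear)
  (lin_comp trip_invl_linear (tmapv_linear al bl))) s => x m.
rewrite tmapvE // !trip_invlE modtens_actE act_r tactE tpairl_l tpairl_r.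
rewrite mulr1 mul1r !tmapvE ?mulr1 //; exact: mulr_linl.
Qed.

Lemma trip_invr_act (a : A) (b : A^c) (s : M ⊗ A) :
  (a ⊗ b : env A) • trip_invr s =
  trip_invr (tmap (fun m => a ▷ m) (fun y => y * (b : A)) s).
Proof.
have bl := mulr_linl (b : A); have al := act_linr (bm_lP M) a.
have Al := act_linr (lm_actP TM) (a ⊗ b).
apply: (tens_ext (lin_comp Al trip_invr_linear)
  (lin_comp trip_invr_linear (tmapv_linear al bl))) s => m y.
rewrite tmapvE // !trip_invrE modtens_actE act_l tactE tpairr_l tpairr_r.
rewrite mulr1 mul1r !tmapvE ?mulr1 //; exact: (mulr_linl (1 : A^c)).
Qed.

Lemma trip_invr_right (x y : A) (m : M) :
  trip_invr ((m ◁ x) ⊗ y) = tpairr 1 (optens (x ⊗ y)) ⊗ (m : bimod_env M).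
Proof.
rewrite trip_invrE act_r tactE tpairr_r mulr1 optensE.
by rewrite tmapvE ?mul1r //; apply: (mulr_linl (x : A^c)).
Qed.
End TripInverse.

(** * Double and triple divergence *)

Section LieDerivative.
Variables (K : fieldType) (A : algType K) (S : {pred A}).

Notation OmA := (Omegabm S).
Notation TM := (modtens (trip A) (OmegaE S)).
Let d : A -> OmA := dOm S.

Let dP : is_der S d := dOm_der S.
Let dl : linear d := der_lin dP.

(** For t = Θ(y) this is dΘ'(y) ⊗ Θ''(y) + Θ'(y) ⊗ dΘ''(y), the part of L_Θ(dy) in which d falls on
    the values of Θ. *)
Definition trip_d (t : A ⊗ A) : TM :=
  trip_invl (tmap id d t : A ⊗ OmA) + trip_invr (tmap d id t : OmA ⊗ A).

Lemma trip_d_linear : linear trip_d.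
Proof.
apply: lin_add.
- exact: lin_comp (@trip_invl_linear _ _ _) (tmapv_linear (@id_linear _ _) dl).
- exact: lin_comp (@trip_invr_linear _ _ _) (tmapv_linear dl (@id_linear _ _)).
Qed.

Lemma trip_dE (x y : A) : trip_d (x ⊗ y) = trip_invl (x ⊗ d y) + trip_invr (d x ⊗ y).
Proof. by rewrite /trip_d !tmapvE. Qed.

(** The defect comes from d(yc) = d(y) c + y dc on the second factor. For t = Θ(y) its coefficient
    [tpairl t 1] is Θ^e(y ⊗ 1); in [trip_d_l], for t = Θ(z), the coefficient [tpairr 1 (optens t)]
    is Θ^e of 1 ⊗ z. *)
Lemma trip_d_r (t : A ⊗ A) (c : A) :
  trip_d (tmap id (fun y => y * c) t) =
  (1 ⊗ (c : A^c) : env A) • trip_d t + tpairl t 1 ⊗ (d c : OmegaE S) :> TM.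
Proof.
have cl := mulr_linl c.
have Al := act_linr (lm_actP TM) (1 ⊗ (c : A^c)).
apply: (tens_ext (lin_comp trip_d_linear (tmapv_linear (@id_linear _ _) cl))
  (lin_add (lin_comp Al trip_d_linear)
    (lin_comp (tpure_linl _ _ _) (tpairl_linl 1)))) t => x y.
rewrite tmapvE // !trip_dE (der_mul dP) tpureDr (linD (@trip_invl_linear _ _ _)).
rewrite (linD (act_linr (lm_actP TM) _)) trip_invl_act trip_invr_act.
rewrite !tmapvE ?mul1r ?(act_1 (bm_lP OmA)) //; try exact: mulr_linl;
  try exact: mulr_linr; try exact: (act_linr (bm_rP OmA)); try exact: (act_linr (bm_lP OmA)).
rewrite -addrA [_ + trip_invr _]addrC addrA; congr (_ + _).
rewrite -trip_invl_left tmapvE //; exact: act_linl (bm_lP OmA) _.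
Qed.

Lemma trip_d_l (t : A ⊗ A) (c : A) :
  trip_d (tmap (fun x => c * x) id t) =
  (c ⊗ (1 : A^c) : env A) • trip_d t + tpairr 1 (optens t) ⊗ (d c : OmegaE S) :> TM.
Proof.
have cl := mulr_linr c.
have Al := act_linr (lm_actP TM) (c ⊗ (1 : A^c)).
apply: (tens_ext (lin_comp trip_d_linear (tmapv_linear cl (@id_linear _ _)))
  (lin_add (lin_comp Al trip_d_linear)
    (lin_comp (tpure_linl _ _ _)
      (lin_comp (tpairr_linr (1 : A)) (@optens_linear _ _))))) t => x y.
rewrite tmapvE // !trip_dE (der_mul dP) tpureDl (linD (@trip_invr_linear _ _ _)).
rewrite (linD (act_linr (lm_actP TM) _)) trip_invl_act trip_invr_act.
rewrite !tmapvE ?mulr1 ?[_ ◁ 1](act_1 (bm_rP OmA)) //; try exact: mulr_linl;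
  try exact: mulr_linr; try exact: (act_linr (bm_rP OmA)); try exact: (act_linr (bm_lP OmA)).
by rewrite [trip_invr (_ ⊗ _) + trip_invr _]addrC addrA trip_invr_right.
Qed.
End LieDerivative.

(** The algebra behind right multiplication in L_Θ, freed from nested tensors. It is applied with s
    = x ⊗ 1, u = 1 ⊗ c and v = y ⊗ 1 in A^e; s and u commute because they live in different factors,
    and evaluating D on su = us is the only input beyond the Leibniz rule. *)
Lemma der_tens_swap (K : fieldType) (B : algType K) (R : {pred B}) (M : bimod B)
    (N : lmod B) (D : B -> M) (DP : is_der R D) (s u v : B) (su : s * u = u * s)
    (m m' : N) (p q : modtens M N) :
  D s ⊗ (u • m + v • m')
    + s • (u • p + (D v ⊗ m' : modtens M N) + (v • q + (D u ⊗ m : modtens M N))) =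
  D u ⊗ (s • m) + u • ((D s ⊗ m : modtens M N) + s • p)
    + (D (s * v) ⊗ m' + (s * v) • q)
  :> modtens M N.
Proof.
have actD b := linD (act_linr (lm_actP (modtens M N)) b).
have actM := act_M (lm_actP (modtens M N)).
have Dsu : (D s ◁ u) ⊗ m + (s ▷ D u) ⊗ m = (D u ◁ s) ⊗ m + (u ▷ D s) ⊗ m
    :> modtens M N.
  by rewrite -!tpureDl -!(der_mul DP) su.
rewrite tpureDr -!tpureB !actD !modtens_actE (der_mul DP) tpureDl -!actM -su.
(* Summands 1 and 6 are the left side of [Dsu]; summands 2 and 4 are the expansion of D(sv) ⊗ m'. *)
by rewrite (AC (2*(2*2)) ((1*6)*3*((2*4)*5))) /= Dsu !addrA.
Qed.

(* The map [trip_mult ⊗ id] read through the isomorphism of [trip(A) ⊗ M] with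
   [(A ⊗ M) ⊕ (M ⊗ A)]. *)
Section TripMultiplication.
Variables (K : fieldType) (A : algType K) (M : bimod A).

Definition tensl_mult (t : A ⊗ M) : M := tlift (fun (x : A) (m : M) => x ▷ m) t.
Definition tensr_mult (t : M ⊗ A) : M := tlift (fun (m : M) (y : A) => m ◁ y) t.
Definition tripM_mult (q : ((A ⊗ M) * (M ⊗ A))%type) : M :=
  tensl_mult q.1 + tensr_mult q.2.

Let tensl_balanced :
  balanced (void_act A) (void_act M) (fun (x : A) (m : M) => x ▷ m).
Proof. exact: void_balanced (act_linl (bm_lP M)) (act_linr (bm_lP M)). Qed.

Let tensr_balanced :
  balanced (void_act M) (void_act A) (fun (m : M) (y : A) => m ◁ y).
Proof. exact: void_balanced (act_linr (bm_rP M)) (act_linl (bm_rP M)). Qed.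

Lemma tensl_multE (x : A) (m : M) : tensl_mult (x ⊗ m) = x ▷ m.
Proof. exact: tliftE tensl_balanced _ _. Qed.

Lemma tensr_multE (m : M) (y : A) : tensr_mult (m ⊗ y) = m ◁ y.
Proof. exact: tliftE tensr_balanced _ _. Qed.

Lemma tensl_mult_linear : linear tensl_mult.
Proof. exact: tlift_linear tensl_balanced. Qed.

Lemma tensr_mult_linear : linear tensr_mult.
Proof. exact: tlift_linear tensr_balanced. Qed.

Lemma tripM_mult_linear : linear tripM_mult.
Proof.
exact: lin_add (lin_comp tensl_mult_linear (@fst_linear K _ _))
  (lin_comp tensr_mult_linear (@snd_linear K _ _)).
Qed.

Lemma trip_mult_inv (q : ((A ⊗ M) * (M ⊗ A))%type) :
  tmap (@trip_mult K A) id (trip_inv q) =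
  (1 : reg (env A)) ⊗ (tripM_mult q : bimod_env M)
  :> modtens (reg (env A)) (bimod_env M).
Proof.
have ml := modtens_map_linear (N := bimod_env M) (@trip_mult_bhom K A).
have mE := modtens_mapE (N := bimod_env M) (@trip_mult_bhom K A).
rewrite trip_invE (linD ml) /tripM_mult tpureDr; congr (_ + _).
- apply: (tens_ext (lin_comp ml (@trip_invl_linear _ _ M))
    (lin_comp (tpure_linr _ _ _) tensl_mult_linear)) => x m.
  rewrite trip_invlE mE trip_multl multAE mulr1 tensl_multE.
  have -> : (x ▷ m : M) = (x ⊗ (1 : A^c) : env A) • (m : bimod_env M).
    by rewrite bimod_envE [_ ◁ _](act_1 (bm_rP M)).
  by rewrite -tpureB [X in _ = X ⊗ _]mul1r.
- apply: (tens_ext (lin_comp ml (@trip_invr_linear _ _ M))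
    (lin_comp (tpure_linr _ _ _) tensr_mult_linear)) => m y.
  rewrite trip_invrE mE trip_multr multAE mulr1 tensr_multE.
  have -> : (m ◁ y : M) = (1 ⊗ (y : A^c) : env A) • (m : bimod_env M).
    by rewrite bimod_envE (act_1 (bm_lP M)).
  by rewrite -tpureB [X in _ = X ⊗ _]mul1r.
Qed.
End TripMultiplication.

(** * Linearity of the integrand of [TDiv], and its image under multiplication *)

Section TripleDivergence.
Variables (K : fieldType) (A : algType K) (S : {pred A}) (Th : A -> A ⊗ A).
Hypothesis ThP : is_der S (Th : A -> outer A).

Notation OmA := (Omegabm S).
Notation TM := (modtens (trip A) (OmegaE S)).
Let d : A -> OmA := dOm S.

Let dP : is_der S d := dOm_der S.
Let dl : linear d := der_lin dP.
Let Th_lin : linear Th := der_lin ThP.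

Let lie (x y : A) : ((A ⊗ OmA) * (OmA ⊗ A))%type :=
  (tmap id (fun z : A => z ▷ d y) (Th x)
     + tmap (fun z : A => x * z) d (Th y) : A ⊗ OmA,
   tmap (fun z : A => x ▷ d z) id (Th y) : OmA ⊗ A).

(** S-linearity of Θ and of d gives Θ(xs) = Θ(x)s, Θ(sy) = sΘ(y) and d(sz) = s dz, which carry s
    across each of the three terms. *)
Lemma dLie_balanced :
  balanced (fun (s : {s : A | s \in S}) (x : A) => x * val s)
    (fun (s : {s : A | s \in S}) (y : A) => val s * y) lie.
Proof.
have dlr (x : A) : linear (fun z => x ▷ d z) := lin_comp (act_linr (bm_lP OmA) x) dl.
have adl (m : OmA) : linear (fun z : A => z ▷ m) := act_linl (bm_lP OmA) m.
have ml := @mulr_linl K A; have mr := @mulr_linr K A; have il := @id_linear K.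
split=> [y|x|[s Ss] x y] /=.
- apply: lin_pair; last by apply: tmapv_linl => // m; apply: adl.
  apply: lin_add; first exact: lin_comp (tmapv_linear (il A) (adl _)) Th_lin.
  exact: tmapv_linl.
- apply: lin_pair; last exact: lin_comp (tmapv_linear (dlr x) (il A)) Th_lin.
  apply: lin_add; last exact: lin_comp (tmapv_linear (mr x) dl) Th_lin.
  by apply: tmapv_linr => // z; apply: dlr.
- have dS z : d (s * z) = s ▷ d z.
    by rewrite (der_mul dP) (der_sub dP Ss) (lin0 (act_linr (bm_rP OmA) z)) add0r.
  have Thl : Th (s * y) = tmap (fun z => s * z) id (Th y).
    by rewrite (der_mul ThP) (der_sub ThP Ss) (lin0 (act_linr (bm_rP (outer A)) y)) add0r.
  have Thr : Th (x * s) = tmap id (fun z => z * s) (Th x).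
    by rewrite (der_mul ThP) (der_sub ThP Ss) (lin0 (act_linr (bm_lP (outer A)) x)) addr0.
  rewrite /lie Thl Thr !tmapv_comp //; congr (_ + _, _).
  + congr tmap; apply/funext => z.
    by rewrite dS (act_M (bm_lP OmA)).
  + by congr tmap; apply/funext => z; rewrite mulrA.
  + by congr tmap; apply/funext => z; rewrite dS (act_M (bm_lP OmA)).
Qed.

(** L_Θ extended by the same formula from Ω^1 to all of A ⊗_S A and read in trip(A) ⊗ Ω^1. *)
Let lieT (t : tens_sub S) : TM := trip_inv (tlift lie t : (A ⊗ OmA) * (OmA ⊗ A)).

Let lieT_linear : linear lieT.
Proof. exact: lin_comp (@trip_inv_linear _ _ _) (tlift_linear dLie_balanced). Qed.

Let D := dder_env Th.
Let DP : is_der (env_sub S) (D : env A -> trip A) := dder_env_der ThP.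

(** Θ(1) = 0 leaves only the first summand of Θ^e(x ⊗ 1), which is the term of L_Θ(x dy) that
    differentiates x. This brings Θ^e into L_Θ, ready to be matched with the connection term. *)
Let lieTE (x y : A) : lieT (x ⊗ y) =
  D (x ⊗ (1 : A^c)) ⊗ (d y : OmegaE S)
    + (x ⊗ (1 : A^c) : env A) • trip_d S (Th y) :> TM.
Proof.
have mr := @mulr_linr K A; have il := @id_linear K.
have r1 : linear (fun m : OmA => m ◁ 1) := act_linr (bm_rP OmA) (1 : A^c).
have lx : linear (fun m : OmA => x ▷ m) := act_linr (bm_lP OmA) x.
rewrite /D /lieT (tliftE dLie_balanced) trip_invE (linD (@trip_invl_linear _ _ _)).
rewrite trip_invl_left (dder_envE ThP) (der1 ThP) (lin0 (@optens_linear _ _)).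
rewrite (lin0 (tpairr_linr x)) addr0 -addrA; congr (_ + _).
rewrite (linD (act_linr (lm_actP TM) _)) trip_invl_act trip_invr_act.
rewrite !tmapv_comp //; last exact: (mulr_linl (1 : A)).
congr (_ + _); [congr (trip_invl _) | congr (trip_invr _)]; congr tmap;
  apply/funext => z.
- by rewrite [_ ◁ 1](act_1 (bm_rP OmA)).
- by rewrite [RHS]mulr1.
Qed.

Let lieT_l (a : A) (t : tens_sub S) :
  lieT (tmap (fun x => a * x) id t : tens_sub S) =
  D (a ⊗ (1 : A^c)) ⊗ (Omega_proj t : OmegaE S)
    + (a ⊗ (1 : A^c) : env A) • lieT t :> TM.
Proof.
have lT := lm_actP TM.
elim/tens_ind: t => [x y|s t Es Et]; last first.
  rewrite (linD (act_linr (outer_lP S) a)) !(linD lieT_linear) Es Et.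
  rewrite (linD (@Omega_proj_linear _ _ S)) (linD (tpure_linr _ _ _)).
  by rewrite [_ • (lieT s + _)](linD (act_linr lT _)) addrACA.
have E : (a * x) ⊗ (1 : A^c) = (a ⊗ (1 : A^c) : env A) * (x ⊗ (1 : A^c) : env A) :> env A.
  by rewrite envM mulr1.
rewrite outer_lE !lieTE Omega_projE E (der_mul DP) tpureDl (act_M lT).
move: (_ • trip_d S (Th y)) => q.
rewrite (linD (act_linr lT _)) modtens_actE addrA; congr (_ + _ + _).
by rewrite tpureB bimod_envE [_ ◁ _](act_1 (bm_rP OmA)).
Qed.

(* The last term vanishes on Ω^1, the kernel of the multiplication. *)
Let lieT_r (c : A) (t : tens_sub S) :
  lieT (tmap id (fun x => x * c) t : tens_sub S) =
  D (1 ⊗ (c : A^c)) ⊗ (Omega_proj t : OmegaE S)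
    + (1 ⊗ (c : A^c) : env A) • lieT t + lieT (tmult t ⊗ c) :> TM.
Proof.
have lT := lm_actP TM.
elim/tens_ind: t => [x y|s t Es Et]; last first.
  rewrite (linD (act_linr (outer_rP S) c)) !(linD lieT_linear) Es Et.
  rewrite (linD (@Omega_proj_linear _ _ S)) (linD (tpure_linr _ _ _)).
  rewrite [_ • (lieT s + _)](linD (act_linr lT _)) (linD (@tmult_linear _ _ S)).
  by rewrite tpureDl (linD lieT_linear) addrACA [X in X + _]addrACA.
pose s := x ⊗ (1 : A^c) : env A; pose u := 1 ⊗ (c : A^c) : env A.
pose v := y ⊗ (1 : A^c) : env A.
have su : s * u = u * s by rewrite !envM !mul1r !mulr1.
have sv : (x * y) ⊗ (1 : A^c) = s * v :> env A by rewrite envM mulr1.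
have Du : D u = tpairr 1 (optens (Th c)).
  by rewrite /D (dder_envE ThP) (der1 ThP) (lin0 (tpairl_linl _)) add0r.
have Dv : D v = tpairl (Th y) 1.
  rewrite /D (dder_envE ThP) (der1 ThP) (lin0 (@optens_linear _ _)).
  by rewrite (lin0 (tpairr_linr _)) addr0.
have actl (m : OmA) (z : A) : z ▷ m = (z ⊗ (1 : A^c) : env A) • (m : OmegaE S).
  by rewrite bimod_envE [_ ◁ _](act_1 (bm_rP OmA)).
have actr (m : OmA) : m ◁ c = u • (m : OmegaE S).
  by rewrite bimod_envE (act_1 (bm_lP OmA)).
have trip_dM : trip_d S (Th (y * c)) =
    u • trip_d S (Th y) + D v ⊗ (d c : OmegaE S)
    + (v • trip_d S (Th c) + D u ⊗ (d y : OmegaE S)) :> TM.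
  by rewrite (der_mul ThP) (linD (@trip_d_linear _ _ S)) trip_d_r trip_d_l Du Dv.
rewrite outer_rE !lieTE Omega_projE tmultE -/s (der_mul dP) trip_dM.
rewrite actl actr -/s -/v sv actl.
exact: (@der_tens_swap K (env A) (env_sub S) (trip A) (OmegaE S) D DP s u v su
  (d y) (d c) _ _).
Qed.

Let dLieT_linear : linear (fun w : Omega S => lieT (Omega_val w)).
Proof.
have vl : linear (@Omega_val K A S) by [].
exact: lin_comp lieT_linear vl.
Qed.

(** Multiplying w by s in A^e adds the same defect Θ^e(s) ⊗ w to the connection term and to L_Θ, so
    it cancels in the difference. It is enough to test s = a ⊗ 1 and s = 1 ⊗ c. *)
Lemma TDiv_lhom (nabla : OmegaE S -> modtens (Omegabm (env_sub S)) (OmegaE S)) :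
  is_connection nabla ->
  is_lhom (fun w : OmegaE S => tmap (iOm (dder_env Th)) id (nabla w)
    - trip_inv (dLie Th w) : TM).
Proof.
move=> nablaP; have lT := lm_actP TM.
have pl := connection_push_linear nablaP DP.
have pE := connection_push nablaP DP.
apply: env_lhom => [k v w|a w|c w].
- by rewrite (pl k v w) [trip_inv _](dLieT_linear k v w) opprD scalerBr addrACA.
- rewrite pE (linB (act_linr lT _)).
  have -> : (a ⊗ (1 : A^c) : env A) • w = (a ▷ (w : OmA) : OmA).
    by rewrite bimod_envE [_ ◁ _](act_1 (bm_rP OmA)).
  rewrite [trip_inv (dLie Th (a ▷ _))](lieT_l a (Omega_val (w : OmA))) Omega_projK.
  by rewrite opprD addrACA subrr add0r.
- rewrite pE (linB (act_linr lT _)).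
  have -> : ((1 : A) ⊗ c : env A) • w = ((w : OmA) ◁ (c : A) : OmA).
    by rewrite bimod_envE (act_1 (bm_lP OmA)).
  rewrite [trip_inv (dLie Th (_ ◁ _))](lieT_r c (Omega_val (w : OmA))) Omega_projK.
  rewrite (eqP (Omega_valP (w : OmA))) [0 ⊗ _](lin0 (tpure_linl _ _ _)).
  by rewrite (lin0 lieT_linear) addr0 opprD addrACA subrr add0r.
Qed.

(** Multiplying out recombines d(Θ')Θ'' + Θ' dΘ'' into d(Θ'Θ''), by the Leibniz rule of d. *)
Lemma Lie_mult (w : Omega S) :
  Lie (fun x => multA (Th x)) w = tripM_mult (dLie Th w).
Proof.
have ml := @multA_linear K A; have tl := @tensl_mult_linear K A OmA.
have tr := @tensr_mult_linear K A OmA; have lx x := act_linr (bm_lP OmA) x.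
have adl (m : OmA) : linear (fun z : A => z ▷ m) := act_linl (bm_lP OmA) m.
have mr := @mulr_linr K A; have il := @id_linear K.
have E : (fun x y => multA (Th x) ▷ d y + x ▷ d (multA (Th y)))
    = (fun x y => tripM_mult (lie x y)).
  apply/funext => x; apply/funext => y.
  rewrite /tripM_mult /= (linD tl) -addrA; congr (_ + _).
  - apply: (tens_ext (lin_comp (adl (d y)) ml)
      (lin_comp tl (tmapv_linear (il A) (adl (d y))))) => u v.
    by rewrite multAE tmapvE // tensl_multE (act_M (bm_lP OmA)).
  - apply: (tens_ext (lin_comp (lx x) (lin_comp dl ml))
      (lin_add (lin_comp tl (tmapv_linear (mr x) dl))
        (lin_comp tr (tmapv_linear (lin_comp (lx x) dl) (il A))))) => u v.
    rewrite multAE (tmapvE _ _ (mr x) dl) (tmapvE _ _ (lin_comp (lx x) dl) (il A)).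
    rewrite tensl_multE tensr_multE (der_mul dP) (linD (lx x)) addrC bm_lr.
    by rewrite (act_M (bm_lP OmA)).
have bal := balanced_comp (@tripM_mult_linear _ _ OmA) dLie_balanced.
rewrite /Lie E.
apply: (tens_ext (tlift_linear bal) (lin_comp (@tripM_mult_linear _ _ OmA)
  (tlift_linear dLie_balanced))) => x y.
by rewrite (tliftE bal) (tliftE dLie_balanced).
Qed.

Lemma Div_mult (nabla : OmegaE S -> modtens (Omegabm (env_sub S)) (OmegaE S)) :
  relatively_formally_smooth S -> is_connection nabla ->
  Div nabla (fun x => multA (Th x)) = trmap_bhom (@trip_mult K A) (TDiv nabla Th).
Proof.
move=> [fgS projS] nablaP; have mP := @trip_mult_bhom K A.
have iP := iOm_bhom DP; have iP' := iOm_bhom (der_comp mP DP).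
have ml := modtens_map_linear (N := OmegaE S) mP.
(* Read backwards, naturality puts both sides under [Tr], and the integrands can be compared
   pointwise. *)
rewrite -(Tr_natural fgS projS mP (TDiv_lhom nablaP)); congr Tr; apply/funext => w.
rewrite (linB ml) trip_mult_inv Lie_mult (der_env_mult ThP); congr (_ - _).
apply: (tens_ext (modtens_map_linear (N := OmegaE S) iP')
  (lin_comp ml (modtens_map_linear (N := OmegaE S) iP))) => v x.
by rewrite !modtens_mapE // (iOm_comp _ mP DP).
Qed.
End TripleDivergence.

(** * Traces of A^e and trip(A) *)

Section TraceIsomorphisms.
Variables (K : fieldType) (A : algType K).

Notation T := (fun x : A => trcl (x : reg A) : trA A).

Let Tl : linear T := @trcl_linear K A (reg A).

Let TC (x y : A) : T (x * y) = T (y * x) := trclC x (y : reg A).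

Let env_tr : env A -> trA A ⊗ trA A :=
  tlift (fun (a : A) (b : A^c) => T a ⊗ T b : trA A ⊗ trA A).

Let env_tr_balanced : balanced (void_act A) (void_act A^c)
  (fun (a : A) (b : A^c) => T a ⊗ T b : trA A ⊗ trA A).
Proof.
apply: void_balanced => [b|a]; first exact: lin_comp (tpure_linl _ _ _) Tl.
exact: lin_comp (tpure_linr _ _ _) Tl.
Qed.

Let env_trE (a : A) (b : A^c) : env_tr (a ⊗ b) = T a ⊗ T b.
Proof. exact: tliftE env_tr_balanced _ _. Qed.

Let env_tr_linear : linear env_tr.
Proof. exact: tlift_linear env_tr_balanced. Qed.

Let env_trC (s t : env A) : env_tr (s * t) = env_tr (t * s).
Proof.
elim/tens_ind: s => [a b|s s' E E']; last by rewrite mulrDl mulrDr !(linD env_tr_linear) E E'.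
elim/tens_ind: t => [c d|t t' E E']; last by rewrite mulrDl mulrDr !(linD env_tr_linear) E E'.
by rewrite !envM !env_trE TC [T (d * b)]TC.
Qed.

Lemma trenv_isoE (s : reg (env A)) : trenv_iso (trcl s) = env_tr s.
Proof. exact: (@tr_liftP _ _ (reg (env A)) _ env_tr env_tr_linear env_trC).2. Qed.

Let trl : (A ⊗ A) ⊗ A^c -> A ⊗ trA A := tlift (fun (xy : A ⊗ A) (z : A^c) =>
  tlift (fun x y : A => (y * x) ⊗ T z : A ⊗ trA A) xy).

Let trr : A ⊗ (A^c ⊗ A^c) -> trA A ⊗ A := tlift (fun (x : A) (yz : A^c ⊗ A^c) =>
  tlift (fun y z : A^c => T x ⊗ ((y : A) * (z : A)) : trA A ⊗ A) yz).

Let trl0_balanced z : balanced (void_act A) (void_act A)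
  (fun x y : A => (y * x) ⊗ T z : A ⊗ trA A).
Proof.
apply: void_balanced => x.
  exact: lin_comp (tpure_linl _ _ _) (mulr_linr x).
exact: lin_comp (tpure_linl _ _ _) (mulr_linl x).
Qed.

Let trr0_balanced x : balanced (void_act A^c) (void_act A^c)
  (fun y z : A^c => T x ⊗ ((y : A) * (z : A)) : trA A ⊗ A).
Proof.
apply: void_balanced => y.
  exact: lin_comp (tpure_linr _ _ _) (mulr_linl (y : A)).
exact: lin_comp (tpure_linr _ _ _) (mulr_linr (y : A)).
Qed.

Let trl_balanced : balanced (void_act (A ⊗ A)) (void_act A^c)
  (fun (xy : A ⊗ A) (z : A^c) => tlift (fun x y : A => (y * x) ⊗ T z : A ⊗ trA A) xy).
Proof.
apply: void_balanced => [z|t k z z']; first exact: tlift_linear (trl0_balanced z).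
elim/tens_ind: t => [x y|s t Es Et].
  by rewrite !(tliftE (trl0_balanced _)) Tl tpure_linr.
by rewrite !(linD (tlift_linear (trl0_balanced _))) Es Et scalerDr addrACA.
Qed.

Let trr_balanced : balanced (void_act A) (void_act (A^c ⊗ A^c))
  (fun (x : A) (yz : A^c ⊗ A^c) =>
    tlift (fun y z : A^c => T x ⊗ ((y : A) * (z : A)) : trA A ⊗ A) yz).
Proof.
apply: void_balanced => [t k x x'|x]; last exact: tlift_linear (trr0_balanced x).
elim/tens_ind: t => [y z|s t Es Et].
  by rewrite !(tliftE (trr0_balanced _)) Tl tpure_linl.
by rewrite !(linD (tlift_linear (trr0_balanced _))) Es Et scalerDr addrACA.
Qed.

Let trl_linear : linear trl := tlift_linear trl_balanced.
Let trr_linear : linear trr := tlift_linear trr_balanced.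

Let T1_linear : linear (tmap T id : A ⊗ trA A -> trA A ⊗ trA A) :=
  tmapv_linear Tl (@id_linear _ _).
Let T2_linear : linear (tmap id T : trA A ⊗ A -> trA A ⊗ trA A) :=
  tmapv_linear (@id_linear _ _) Tl.

(** [trip_mult] yields xy where [trtrip_iso] yields yx, and zy where it yields yz in the opposite
    factors; the orders agree after passing to |A|. *)
Lemma trenv_iso_mult (t : tr (trip A)) :
  trenv_iso (trmap_bhom (@trip_mult K A) t) =
  tmap T id (trtrip_iso t).1 + tmap id T (trtrip_iso t).2.
Proof.
(* Maps induced on a quotient are evaluated at [qrepr t], so both sides become linear functions of
   one and the same element of trip(A). *)
rewrite [LHS]trenv_isoE /trtrip_iso /qlift /= -/trl -/trr; move: (qrepr t) => p.
have rl := lin_add (lin_comp T1_linear (lin_comp trl_linear (@fst_linear K _ _)))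
  (lin_comp T2_linear (lin_comp trr_linear (@snd_linear K _ _))).
have ll := lin_comp env_tr_linear (@trip_mult_linear K A).
elim/tpair_ind: p => [s z|x s|p q E E'].
- rewrite trip_multl /= (lin0 trr_linear) (lin0 T2_linear) addr0 [trl _](tliftE trl_balanced).
  apply: (tens_ext (lin_comp env_tr_linear (lin_comp (tpure_linl _ _ z) (@multA_linear K A)))
    (lin_comp T1_linear (tlift_linear (trl0_balanced z)))) => x y.
  by rewrite multAE env_trE (tliftE (trl0_balanced z)) tmapvE // TC.
- rewrite trip_multr /= (lin0 trl_linear) (lin0 T1_linear) add0r [trr _](tliftE trr_balanced).
  have ml : linear (fun t : A^c ⊗ A^c => x ⊗ (multA t : A^c) : env A).
    exact: lin_comp (tpure_linr _ _ x) (@multA_linear K A^c).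
  apply: (tens_ext (lin_comp env_tr_linear ml)
    (lin_comp T2_linear (tlift_linear (trr0_balanced x)))) => y z.
  by rewrite multAE env_trE (tliftE (trr0_balanced x)) tmapvE // [T (y * z)]TC.
- rewrite [LHS](linD ll) E E'; exact: esym (linD rl p q).
Qed.

Lemma trfst_isoE (V : lmodType K) (m : tensfst A V) :
  trfst_iso (trcl m) = tmap T id m.
Proof.
have Vl : linear (tmap T id : A ⊗ V -> trA A ⊗ V) := tmapv_linear Tl (@id_linear _ _).
have Ll b := act_linr (bm_lP (tensfst A V)) b.
have Lr (b : A) := act_linr (bm_rP (tensfst A V)) b.
have C b (t : tensfst A V) : tmap T id (b ▷ t) = tmap T id (t ◁ b) :> trA A ⊗ V.
  apply: (tens_ext (lin_comp Vl (Ll b)) (lin_comp Vl (Lr b))) => x v.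
  rewrite [b ▷ _](tmapvE _ _ (mulr_linr b) (@id_linear _ _)).
  rewrite [_ ◁ b](tmapvE _ _ (mulr_linl b) (@id_linear _ _)).
  by rewrite !(tmapvE _ _ Tl (@id_linear _ _)) TC.
exact: (@tr_liftP _ _ (tensfst A V) _ (tmap T id) Vl C).2.
Qed.

(** Exchanging the factors of |ae'| ⊗ |e''| gives |e'| ⊗ |ae''| by symmetry of e, and |ae''| =
    |e''a|. *)
Lemma sym_tr_ad (e : A ⊗ A) (he : tswap e = e) (a : A) :
  sym (tmap T T (ad (e : outer A) a) : trA A ⊗ trA A) = 0.
Proof.
have TTl : linear (tmap T T : A ⊗ A -> trA A ⊗ trA A) := tmapv_linear Tl Tl.
have al := mulr_linr a; have ar := mulr_linl a; have il := @id_linear K A.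
have E : tmap T T (tmap id (fun x => x * a) e : A ⊗ A) =
    tswap (tmap T T (tmap (fun x => a * x) id e : A ⊗ A)) :> trA A ⊗ trA A.
  rewrite tswap_tmap // tswap_tmap // he !tmapv_comp //.
  by congr tmap; apply/funext => x; rewrite TC.
rewrite /ad (linB TTl) (linB (@sym_linear K _)).
by rewrite [X in _ - sym X]E sym_tswap subrr.
Qed.
End TraceIsomorphisms.

(** * Comparison of the symmetrized divergence with the modular vector field *)

Lemma double_bracket_der (K : fieldType) (A : algType K) (S : {pred A})
    (Pi : A ⊗ A -> A ⊗ A) (a : A) :
  is_double_bracket S Pi -> is_der S (fun x => Pi (a ⊗ x) : outer A).
Proof.
move=> [Pl Pr _ PS _]; split=> [|x y|s Ss]; last exact: PS.
- exact: lin_comp Pl (tpure_linr _ _ a).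
- exact: Pr.
Qed.

(* Both sides are computed from the representative [qrepr u] of u, so it does not
   matter here that Ham_Π and |m| are well defined on |A|. *)
Lemma sym_delta (K : fieldType) (A : algType K) (S : {pred A})
    (hA : relatively_formally_smooth S)
    (nabla : OmegaE S -> modtens (Omegabm (env_sub S)) (OmegaE S))
    (hnabla : is_connection nabla)
    (Pi : A ⊗ A -> A ⊗ A) (hPi : is_double_bracket S Pi)
    (e : A ⊗ A) (he : tswap e = e) (u : trA A) :
  sym (delta nabla Pi u) = sym (tr_modular nabla Pi (ad (e : outer A)) u).
Proof.
have Tl : linear (fun x : A => trcl (x : reg A) : trA A) := @trcl_linear K A (reg A).
have sl := linD (@sym_linear K (trA A)).
have T1 := linD (tmapv_linear Tl (@id_linear K (trA A))).
rewrite [tr_modular _ _ _ _]trfst_isoE /modular T1 sl tmapv_comp // sym_tr_ad // addr0.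
rewrite /fd T1 sl -tswap_tmap // sym_tswap -sl; congr sym.
rewrite -trenv_iso_mult -(Div_mult _ hA hnabla) //.
exact: double_bracket_der.
Qed.

Theorem theorem3p20 (K : fieldType) (hK : [pchar K] =i pred0)
    (A : algType K) (S : {pred A}) (hS : subalg_closed S)
    (hA : relatively_formally_smooth S)
    (nabla : OmegaE S -> modtens (Omegabm (env_sub S)) (OmegaE S))
    (hnabla : is_connection nabla)
    (Pi : A ⊗ A -> A ⊗ A) (hPi : is_double_bracket S Pi)
    (e : A ⊗ A) (he : tswap e = e)
    (had : is_der S (ad (e : outer A)))
    (hPie : forall a b : A,
       Pi (a ⊗ b) + dbop Pi (a ⊗ b) = ad_dder (ad (e : outer A)) a b) :
  (skew_symmetric (delta nabla Pi) <->
     forall u, sym (tr_modular nabla Pi (ad (e : outer A)) u) = 0) /\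
  ((forall a, modular nabla Pi (ad (e : outer A)) a = 0) ->
     skew_symmetric (delta nabla Pi)).
Proof.
have E := sym_delta hA hnabla hPi he.
split=> [|m0 u]; first by split=> H u; have := H u; rewrite E.
have Tl : linear (fun x : A => trcl (x : reg A) : trA A) := @trcl_linear K A (reg A).
rewrite E [tr_modular _ _ _ _]trfst_isoE m0.
by rewrite (lin0 (tmapv_linear Tl (@id_linear K _))) (lin0 (@sym_linear K _)).
Qed.
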